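(* Let $r>t\ge 1$ be integers. There exists $n_0=n_0(r,t)$ such that for all $n>n_0$ the following holds. If an $n$-vertex graph $G$ is non-trivial $(K_r,t)$-intersecting, then $$N(K_r,G)\le N\bigl(K_r,\;K_{t+2}+T(n-t-2,\,r-t-1)\bigr),$$ and equality holds if and only if $G$ is isomorphic to $K_{t+2}+T(n-t-2,\,r-t-1)$.
   Context: $N(K_r,G)$ denotes the number of copies of the complete graph $K_r$ on $r$ vertices in the graph $G$. The associated $r$-graph of a graph $G$ is $\mathcal{H}_G^r=\{S\in\binom{V(G)}{r}: G[S]\cong K_r\}$, where $G[S]$ is the induced subgraph. A family $\mathcal{F}$ of $r$-sets is $t$-intersecting if any two distinct members have intersection of size at least $t$; it is non-trivial $t$-intersecting if it is $t$-intersecting and $|\bigcap_{A\in\mathcal{F}}A|<t$. A graph $G$ is non-trivial $(K_r,t)$-intersecting if $\mathcal{H}_G^r$ is non-trivial $t$-intersecting. The Turán graph $T(n,k)$ is the balanced complete $k$-partite graph on $n$ vertices. $G+H$ denotes the graph obtained from the vertex-disjoint union of $G$ and $H$ by adding all edges between $V(G)$ and $V(H)$.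
   Formalization: For r = t+1 the graph T(n-t-2, 0) does not exist (no complete 0-partite graph has vertices); the formal statement takes it to be the complete graph on n-t-2 vertices, so that case carries no content, and all cases r ≥ t+2 are as stated. *)

(* Defs.v *)
From mathcomp Require Import all_boot.

Set Implicit Arguments.
Unset Strict Implicit.
Unset Printing Implicit Defensive.

Record sgraph := SGraph {
  vertex :> finType;
  adj : rel vertex;
  adj_sym : symmetric adj;
  adj_irrefl : irreflexive adj
}.

Definition isomorphic (G H : sgraph) : bool :=
  [exists f : {ffun G -> H},
    [&& injectiveb f, [set f x | x : G] == [set: H]
      & [forall x, forall y, adj (f x) (f y) == adj x y]]].

Lemma isomorphicP (G H : sgraph) :
  reflect (exists2 f : G -> H, bijective f & {mono f : x y / adj x y})
          (isomorphic G H).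
Proof.
apply: (iffP existsP) => [[f /and3P[/injectiveP f_inj /eqP f_surj f_adj]]|].
  exists f; last by move=> x y; apply/eqP; move/forallP/(_ x)/forallP: f_adj.
  apply: inj_card_bij => //.
  by rewrite -(card_imset _ f_inj) f_surj cardsT.
move=> [f [g fK gK] f_adj]; exists [ffun x => f x]; apply/and3P; split.
- by apply/injectiveP=> x y; rewrite !ffunE; apply: (can_inj fK).
- apply/eqP/setP=> y; rewrite inE; apply/imsetP.
  by exists (g y) => //; rewrite ffunE gK.
- by apply/forallP=> x; apply/forallP=> y; rewrite !ffunE f_adj.
Qed.

Definition complete_adj (n : nat) : rel 'I_n := fun i j => i != j.
Fact complete_sym n : symmetric (@complete_adj n).
Proof. by move=> i j; rewrite /complete_adj eq_sym. Qed.
Fact complete_irrefl n : irreflexive (@complete_adj n).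
Proof. by move=> i; rewrite /complete_adj eqxx. Qed.
Definition complete (n : nat) : sgraph :=
  SGraph (@complete_sym n) (@complete_irrefl n).

(* The parts are the residue classes modulo [k], whose sizes differ by at     *)
(* most one.  No complete 0-partite graph on [n > 0] vertices exists; since   *)
(* [i %% 0 = i], the value given here to [turan n 0] is the complete graph.   *)
Definition turan_adj (n k : nat) : rel 'I_n := fun i j => i != j %[mod k].
Fact turan_sym n k : symmetric (@turan_adj n k).
Proof. by move=> i j; rewrite /turan_adj eq_sym. Qed.
Fact turan_irrefl n k : irreflexive (@turan_adj n k).
Proof. by move=> i; rewrite /turan_adj eqxx. Qed.
Definition turan (n k : nat) : sgraph :=
  SGraph (@turan_sym n k) (@turan_irrefl n k).

Definition join_adj (G H : sgraph) : rel (G + H) := fun u v =>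
  match u, v with
  | inl x, inl y => adj x y
  | inr x, inr y => adj x y
  | _, _ => true
  end.
Fact join_sym (G H : sgraph) : symmetric (@join_adj G H).
Proof. by move=> [x|x] [y|y] //=; apply: adj_sym. Qed.
Fact join_irrefl (G H : sgraph) : irreflexive (@join_adj G H).
Proof. by move=> [x|x] /=; apply: adj_irrefl. Qed.
Definition join (G H : sgraph) : sgraph :=
  SGraph (@join_sym G H) (@join_irrefl G H).

Definition induced_adj (G : sgraph) (S : {set G}) : rel {x : G | x \in S} :=
  fun u v => adj (val u) (val v).
Fact induced_sym (G : sgraph) (S : {set G}) : symmetric (induced_adj (S := S)).
Proof. by move=> u v; apply: adj_sym. Qed.
Fact induced_irrefl (G : sgraph) (S : {set G}) : irreflexive (induced_adj (S := S)).
Proof. by move=> u; apply: adj_irrefl. Qed.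
Definition induced (G : sgraph) (S : {set G}) : sgraph :=
  SGraph (@induced_sym G S) (@induced_irrefl G S).

Definition associated_hypergraph (r : nat) (G : sgraph) : {set {set G}} :=
  [set S : {set G} | (#|S| == r) && isomorphic (induced S) (complete r)].

(* A copy of K_r in G is determined by its vertex set. *)
Definition num_cliques (r : nat) (G : sgraph) : nat :=
  #|associated_hypergraph r G|.

Definition t_intersecting (T : finType) (t : nat) (F : {set {set T}}) : Prop :=
  forall A B, A \in F -> B \in F -> A != B -> t <= #|A :&: B|.

Definition nontrivial_t_intersecting (T : finType) (t : nat)
    (F : {set {set T}}) : Prop :=
  t_intersecting t F /\ #|\bigcap_(A in F) A| < t.

Definition nontrivial_clique_intersecting (r t : nat) (G : sgraph) : Prop :=
  nontrivial_t_intersecting t (associated_hypergraph r G).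

(* Main.v *)
(* Write r = t + k + 1 with k > 0 (for k = 0 the extremal graph is complete).
   Call a (t+1)-set heavy if it lies in more than r n^(k-1) of the r-cliques.
   A heavy set behaves like the kernel of a sunflower: it meets every
   r-clique, and every other heavy set, in at least t vertices. All but
   O(n^(k-1)) of the r-cliques contain a heavy set, and a heavy set lies in
   at most t_k(n) + O(n^(k-1)) of them, t_k(n) being the number of K_k in
   T(n,k); so at most t+1 heavy sets leave too few r-cliques, the extremal
   graph having about (t+2) t_k(n). With t+2 heavy sets or more, either they
   all contain a common t-set and are at least three, and there are only
   t_k(n) + O(n^(k-1)) r-cliques, or they are all the (t+1)-subsets of a
   (t+2)-set W. Then every r-clique misses at most one vertex of W, the
   common neighbourhoods of the heavy sets outside W are K_(k+1)-free, and
   Zykov's theorem gives the exact bound together with the case of equality. *)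
Require Import Defs.
From mathcomp Require Import all_boot zify.

Set Implicit Arguments.
Unset Strict Implicit.
Unset Printing Implicit Defensive.

(** * Elementary symmetric functions of balanced sequences *)

(** The elementary symmetric polynomial of degree [s] in the entries of [l]. With part sizes as
    entries it counts the [s]-cliques of a complete multipartite graph. *)
Fixpoint elemsym (l : seq nat) (s : nat) : nat :=
  if l is x :: l' then elemsym l' s + (if s is s'.+1 then x * elemsym l' s' else 0)
  else s == 0.

Lemma elemsym0 l : elemsym l 0 = 1.
Proof. by elim: l => //= x l ->. Qed.

Lemma elemsym_consS x l s : elemsym (x :: l) s.+1 = elemsym l s.+1 + x * elemsym l s.
Proof. by []. Qed.

Lemma elemsym_big l s : size l < s -> elemsym l s = 0.
Proof.
elim: l s => [|x l IH] [|s] //= ls; rewrite !IH ?muln0 //.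
exact: ltnW.
Qed.

Lemma elemsym_size_cons x l : elemsym (x :: l) (size l).+1 = x * elemsym l (size l).
Proof. by rewrite elemsym_consS elemsym_big. Qed.

Lemma elemsym_size l : elemsym l (size l) = \prod_(x <- l) x.
Proof.
elim: l => [|x l IH]; first by rewrite big_nil.
by rewrite big_cons elemsym_size_cons IH.
Qed.

Lemma elemsym_swap x y l s : elemsym (x :: y :: l) s = elemsym (y :: x :: l) s.
Proof. by case: s => [|[|s]] //=; rewrite ?elemsym0; nia. Qed.

Lemma elemsym_cons_congr x l l' :
  elemsym l =1 elemsym l' -> elemsym (x :: l) =1 elemsym (x :: l').
Proof. by move=> E [|s] /=; rewrite !E. Qed.

Lemma elemsym_middle x l1 l2 : elemsym (l1 ++ x :: l2) =1 elemsym (x :: l1 ++ l2).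
Proof.
elim: l1 => [|y l1 IH] // s.
by rewrite [LHS](elemsym_cons_congr y IH) elemsym_swap.
Qed.

Lemma elemsym_perm l l' : perm_eq l l' -> elemsym l =1 elemsym l'.
Proof.
elim: l l' => [|x l IH] l' ll'.
  by move: ll'; rewrite perm_sym => /perm_nilP ->.
have xl' : x \in l' by rewrite -(perm_mem ll') mem_head.
case/splitPr: xl' ll' => p1 p2 ll' s.
rewrite elemsym_middle; apply: elemsym_cons_congr; apply: IH.
by rewrite -(perm_cons x) (permPl ll') -cat1s perm_catCA.
Qed.

(** Moving a unit between two entries keeps their sum and changes their product by
    [a (b + 1) - (a + 1) b = a - b], so only the terms using both entries change. The signed
    difference is split over the two sides because subtraction on [nat] truncates. *)
Lemma elemsym_exchange a b l s :
  elemsym (a.+1 :: b :: l) s + (a - b) * (if s is s'.+2 then elemsym l s' else 0)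
  <= elemsym (a :: b.+1 :: l) s + (b - a) * (if s is s'.+2 then elemsym l s' else 0).
Proof. by case: s => [|[|s]] /=; rewrite ?elemsym0; nia. Qed.

(** The part sizes of the Turan graph [T(m,k)]. The larger parts come first, matching the residues
    [i < m %% k]. *)
Definition bal (m k : nat) : seq nat :=
  nseq (m %% k) (m %/ k).+1 ++ nseq (k - m %% k) (m %/ k).

Lemma size_bal m k : 0 < k -> size (bal m k) = k.
Proof. by move=> k0; rewrite size_cat !size_nseq subnKC // ltnW // ltn_mod. Qed.

Lemma sumn_bal m k : 0 < k -> sumn (bal m k) = m.
Proof.
move=> k0; rewrite sumn_cat !sumn_nseq.
by have := divn_eq m k; have := ltn_mod m k; rewrite k0; nia.
Qed.

Lemma elemsym_bal_size m k : 0 < k ->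
  elemsym (bal m k) k = (m %/ k).+1 ^ (m %% k) * (m %/ k) ^ (k - m %% k).
Proof.
move=> k0; rewrite -{2}(size_bal m k0) elemsym_size big_cat /=.
by rewrite !big_nseq !iter_muln_1.
Qed.

Lemma elemsym_bal_le m k : 0 < k -> elemsym (bal m k) k <= (m %/ k).+1 ^ k.
Proof.
move=> k0; rewrite elemsym_bal_size //.
have jk : m %% k <= k by rewrite ltnW ?ltn_mod.
rewrite -[X in _ <= _ ^ X](subnKC jk) expnD leq_mul2l.
by apply/orP; right; case: (k - m %% k) => // i; rewrite leq_exp2r.
Qed.

Lemma elemsym_bal_ge m k : 0 < k -> (m %/ k) ^ k <= elemsym (bal m k) k.
Proof.
move=> k0; rewrite elemsym_bal_size //.
have jk : m %% k <= k by rewrite ltnW ?ltn_mod.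
rewrite -[X in _ ^ X <= _](subnKC jk) expnD leq_mul2r.
by apply/orP; right; case: (m %% k) => // i; rewrite leq_exp2r.
Qed.

Definition balanced (l : seq nat) := all (fun a => all (fun b => a <= b.+1) l) l.

Lemma balancedP l :
  reflect {in l &, forall a b, a <= b.+1} (balanced l).
Proof.
apply: (iffP allP) => [H a b al bl|H a al]; first exact: (allP (H a al)).
by apply/allP => b bl; apply: H.
Qed.

Lemma perm_two_values (l : seq nat) q :
  {in l, forall x, (x == q.+1) || (x == q)} ->
  perm_eq l (nseq (count_mem q.+1 l) q.+1 ++ nseq (size l - count_mem q.+1 l) q).
Proof.
move=> lq; rewrite -(perm_filterC (pred1 q.+1) l).
have -> : size l - count_mem q.+1 l = count (predC (pred1 q.+1)) l.
  by rewrite -(count_predC (pred1 q.+1) l) addKn.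
rewrite -!size_filter.
have /all_pred1P <- : all (pred1 q.+1) (filter (pred1 q.+1) l) by apply: filter_all.
have /all_pred1P <- // : all (pred1 q) (filter (predC (pred1 q.+1)) l).
by apply/allP => x; rewrite mem_filter => /andP[/= xq /lq]; rewrite (negbTE xq).
Qed.

(** If [q] is the least entry, every entry is [q] or [q + 1], and fewer than [size l] of them are
    [q + 1]. Division of the sum by the size therefore returns [q] and the number of larger
    entries. *)
Lemma perm_bal l : balanced l -> perm_eq l (bal (sumn l) (size l)).
Proof.
case: (posnP (size l)) => [/size0nil -> //|l0] /balancedP lb.
have exq : exists q, q \in l by case: l l0 {lb} => // x l _; exists x; rewrite mem_head.
case: (ex_minnP exq) => q ql qmin.
have lq : {in l, forall x, (x == q.+1) || (x == q)}.
  by move=> x xl; have := qmin x xl; have := lb _ _ xl ql; lia.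
have lp := perm_two_values lq.
set j := count_mem q.+1 l in lp.
have jl : j < size l.
  rewrite ltn_neqAle count_size andbT -all_count; apply/negP => /allP /(_ _ ql) /=.
  by rewrite ltn_eqF.
have sl : sumn l = q * size l + j.
  by rewrite (perm_sumn lp) sumn_cat !sumn_nseq; nia.
by rewrite /bal sl divnMDl // modnMDl divn_small // modn_small // addn0.
Qed.

Lemma unbalanced_perm l : ~~ balanced l ->
  exists a b l', perm_eq l (a.+1 :: b :: l') /\ b < a.
Proof.
case/allPn => x xl /allPn[b bl]; rewrite -ltnNge => bx.
have xb : b \in rem x l.
  by move: bl; rewrite (perm_mem (perm_to_rem xl)) inE ltn_eqF // ltnW.
exists x.-1, b, (rem b (rem x l)); split; last by lia.
have -> : x.-1.+1 = x by lia.
rewrite (permPl (perm_to_rem xl)) perm_cons; exact: perm_to_rem.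
Qed.

(** Moving a unit from an entry to one smaller by at least two does not lower [elemsym] and strictly
    lowers the sum of squares, on which the induction runs. *)
Lemma elemsym_bal_max l s :
  elemsym l s <= elemsym (bal (sumn l) (size l)) s.
Proof.
have [n] := ubnP (\sum_(x <- l) x ^ 2); elim: n l => // n IH l ln.
case: (boolP (balanced l)) => [/perm_bal/elemsym_perm <- //|].
case/unbalanced_perm => a [b [l' [lp ba]]].
rewrite (elemsym_perm lp) (perm_size lp) (perm_sumn lp).
move: ln; rewrite (perm_big _ lp) !big_cons /= => ln.
have -> : a.+1 + (b + sumn l') = sumn (a :: b.+1 :: l') by rewrite /=; lia.
apply: leq_trans (IH (a :: b.+1 :: l') _); last by rewrite !big_cons; nia.
have := elemsym_exchange a b l' s.
have -> : b - a = 0 by lia.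
rewrite mul0n addn0; apply: leq_trans; exact: leq_addr.
Qed.

(** In top degree the exchange gains a positive multiple of the product of the remaining entries.
    That product is nonzero by assumption, so an unbalanced sequence is not optimal. *)
Lemma elemsym_bal_eq l : 0 < elemsym l (size l) ->
  elemsym l (size l) = elemsym (bal (sumn l) (size l)) (size l) ->
  perm_eq l (bal (sumn l) (size l)).
Proof.
move=> l0 le; apply: perm_bal; apply: contraPT le => /unbalanced_perm.
case=> a [b [l' [lp ba]]].
move: l0; rewrite (elemsym_perm lp) (perm_size lp) (perm_sumn lp) => l0 le.
have := elemsym_bal_max (a :: b.+1 :: l') (size l').+2.
have -> : sumn (a :: b.+1 :: l') = sumn (a.+1 :: b :: l') by rewrite /=; lia.
have := elemsym_exchange a b l' (size l').+2.
have Pl : 0 < elemsym l' (size l').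
  move: l0; rewrite (@elemsym_size_cons _ (b :: l')) (@elemsym_size_cons b).
  by rewrite !muln_gt0 => /and3P[].
rewrite -/(size (b.+1 :: l')) in le *.
move: (elemsym (a.+1 :: _) _) (elemsym (a :: _) _) (elemsym (bal _ _) _) le Pl => x y z.
nia.
Qed.

(** Add all of [m - d] to one entry, then rebalance. *)
Lemma elemsym_bal_mono d m k s : d <= m -> 0 < k ->
  elemsym (bal d k) s <= elemsym (bal m k) s.
Proof.
move=> dm k0; have := size_bal d k0; have := sumn_bal d k0.
case: (bal d k) => [|x l] sl zl; first by rewrite -zl in k0.
have := elemsym_bal_max (x + (m - d) :: l) s.
have -> : sumn (x + (m - d) :: l) = m by move: sl => /=; lia.
rewrite [size _]zl; apply: leq_trans; case: s => [|s] //=.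
by rewrite leq_add2l leq_mul2r leq_addr orbT.
Qed.

(** The top degree is a product, so enlarging one factor of a nonzero product is a strict gain. *)
Lemma elemsym_bal_smono d m k : d < m -> 0 < k -> 0 < elemsym (bal d k) k ->
  elemsym (bal d k) k < elemsym (bal m k) k.
Proof.
move=> dm k0; have := size_bal d k0; have := sumn_bal d k0.
case: (bal d k) => [|x l] sl zl; first by rewrite -zl in k0.
subst k; have := elemsym_bal_max (x + (m - d) :: l) (size l).+1.
have -> : sumn (x + (m - d) :: l) = m by move: sl => /=; lia.
rewrite [size (_ :: _)]/= !elemsym_size_cons muln_gt0.
move=> H /andP[x0 l0]; apply: leq_trans H.
by rewrite ltn_pmul2r //; lia.
Qed.

Lemma elemsym_nseq1_cons n l : elemsym (nseq n 1 ++ l) (n + size l) = elemsym l (size l).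
Proof.
elim: n => // n IH; rewrite addSn [_ ++ _]/= elemsym_consS mul1n IH.
by rewrite elemsym_big // size_cat size_nseq.
Qed.

(** A product of all entries but one omits either one of the [n] ones or one entry of [l]. *)
Lemma elemsym_nseq1_cons_pred n l s : size l = s.+1 ->
  elemsym (nseq n 1 ++ l) (n + s) = n * elemsym l (size l) + elemsym l s.
Proof.
move=> ls; elim: n => [|n IH]; first by rewrite mul0n.
rewrite addSn [_ ++ _]/= elemsym_consS mul1n IH -addnS -ls elemsym_nseq1_cons.
by rewrite mulSn addnA.
Qed.

(** * Polynomial growth estimates *)

Lemma expnD_le c k : exists B, forall q, 0 < q ->
  (q + c) ^ k.+1 <= q ^ k.+1 + B * q ^ k.
Proof.
elim: k => [|k [B HB]]; first by exists c => q _; rewrite !expn1 muln1.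
(* Coefficients of [(q + c) (q^(k+1) + B q^k)] below the leading one, with [q^k] bounded by
   [q^(k+1)]. *)
exists (B + c + c * B) => q q0; rewrite expnS.
apply: leq_trans (leq_mul (leqnn _) (HB q q0)) _.
rewrite (expnS q k.+1) (expnS q k); move: (q ^ k) => z; nia.
Qed.

(** Both sides have degree [k + 1] in [q], with leading coefficients [t] and [t + 1]; shifting [q]
    by a constant costs only lower-order terms. *)
Lemma growth_gap c C t k : exists M, forall q, M < q ->
  t * (q + c) ^ k.+1 + C * (q + c) ^ k < t.+1 * q ^ k.+1.
Proof.
have [B HB] := expnD_le c k.
(* The total coefficient of [q^k] on the left, using [(q + c)^k <= (1 + c)^k q^k]. *)
exists (t * B + C * (1 + c) ^ k) => q Mq; have q0 : 0 < q by lia.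
have h1 : (q + c) ^ k <= (1 + c) ^ k * q ^ k.
  by rewrite -expnMn; case: k {HB Mq B} => // k; rewrite leq_exp2r //; nia.
have qk : 0 < q ^ k by rewrite expn_gt0 q0.
apply: leq_ltn_trans (leq_add (leq_mul (leqnn t) (HB q q0)) (leq_mul (leqnn C) h1)) _.
rewrite expnS; move: (q ^ k) qk ((1 + c) ^ k) Mq => z z0 y Mq.
have : (t * B + C * y) * z < q * z by rewrite ltn_pmul2r.
nia.
Qed.

Lemma leq_card_bigcup (I T : finType) (P : pred I) (F : I -> {set T}) :
  #|\bigcup_(i | P i) F i| <= \sum_(i | P i) #|F i|.
Proof.
elim/big_rec2: _ => [|i n A _ IH]; first by rewrite cards0.
by apply: leq_trans (leq_card_setU _ _) _; rewrite leq_add2l.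
Qed.

(** * Counting cliques *)

Definition clique (G : sgraph) (S : {set G}) : bool :=
  [forall x in S, forall y in S, (x != y) ==> adj x y].

Lemma cliqueP (G : sgraph) (S : {set G}) :
  reflect {in S &, forall x y, x != y -> adj x y} (clique S).
Proof.
apply: (iffP forall_inP) => [H x y xS yS|H x xS].
  by move/forall_inP: (H x xS) => /(_ y yS)/implyP.
by apply/forall_inP => y yS; apply/implyP; apply: H.
Qed.

Definition nbr (G : sgraph) (x : G) : {set G} := [set y | adj x y].

(** Relative to a vertex set [X], so that inductions pass to subsets of one fixed graph instead of
    to induced subgraphs. *)
Definition cliques (G : sgraph) (s : nat) (X : {set G}) : {set {set G}} :=
  [set S : {set G} | [&& S \subset X, #|S| == s & clique S]].

Lemma cliquesP (G : sgraph) s (X S : {set G}) :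
  reflect [/\ S \subset X, #|S| = s & clique S] (S \in cliques s X).
Proof. by rewrite inE; apply: (iffP and3P) => [[? /eqP]|[? /eqP]]. Qed.

Lemma clique_sub (G : sgraph) (A B : {set G}) : A \subset B -> clique B -> clique A.
Proof.
move=> /subsetP AB /cliqueP H; apply/cliqueP => x y xA yA; apply: H; exact: AB.
Qed.

Lemma cliqueU (G : sgraph) (A B : {set G}) : clique A -> clique B ->
  {in A & B, forall x y, x != y -> adj x y} -> clique (A :|: B).
Proof.
move=> /cliqueP cA /cliqueP cB AB; apply/cliqueP => x y.
rewrite !inE => /orP[xA|xB] /orP[yA|yB] xy; first exact: cA; last exact: cB.
  exact: AB.
by rewrite adj_sym; apply: AB; rewrite // eq_sym.
Qed.

Lemma clique_setU1 (G : sgraph) (x : G) (S : {set G}) :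
  clique S -> S \subset nbr x -> clique (x |: S).
Proof.
move=> cS /subsetP Sx; apply: cliqueU => //.
  by apply/cliqueP => y z /set1P -> /set1P ->; rewrite eqxx.
by move=> y z /set1P -> /Sx; rewrite inE.
Qed.

Lemma clique_nbr (G : sgraph) (x : G) (S : {set G}) :
  clique S -> x \in S -> S :\ x \subset nbr x.
Proof.
move=> /cliqueP cS xS; apply/subsetP => y /setD1P[yx yS].
by rewrite inE; apply: cS; rewrite // eq_sym.
Qed.

Lemma nbr_notin (G : sgraph) (x : G) (S : {set G}) : S \subset nbr x -> x \notin S.
Proof. by move=> /subsetP H; apply/negP => /H; rewrite inE adj_irrefl. Qed.

Lemma cliquesS (G : sgraph) s (X Y : {set G}) :
  X \subset Y -> cliques s X \subset cliques s Y.
Proof.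
move=> XY; apply/subsetP => S /cliquesP[SX cS kS].
by apply/cliquesP; split => //; apply: subset_trans XY.
Qed.

Lemma cliques0 (G : sgraph) (X : {set G}) : cliques 0 X = [set set0].
Proof.
apply/setP => S; rewrite in_set1; apply/cliquesP/eqP => [[_ /cards0_eq]//|->].
by split; rewrite ?sub0set ?cards0 //; apply/cliqueP => x y; rewrite inE.
Qed.

Lemma cliques_set0 (G : sgraph) s : cliques s.+1 (set0 : {set G}) = set0.
Proof.
apply/setP => S; rewrite in_set0; apply/negP => /cliquesP[].
by rewrite subset0 => /eqP ->; rewrite cards0.
Qed.

Lemma card_cliques_link (G : sgraph) s (X : {set G}) (v : G) : v \in X ->
  #|[set S in cliques s.+1 X | v \in S]| = #|cliques s (X :&: nbr v)|.
Proof.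
move=> vX.
have inj : {in cliques s (X :&: nbr v) &, injective (fun S => v |: S)}.
  move=> S T /cliquesP[SX _ _] /cliquesP[TX _ _] ST.
  have vS : v \notin S by apply: nbr_notin; apply: subset_trans SX (subsetIr _ _).
  have vT : v \notin T by apply: nbr_notin; apply: subset_trans TX (subsetIr _ _).
  by rewrite -(setU1K vS) ST setU1K.
rewrite -(card_in_imset inj); congr #|pred_of_set _|; apply/setP => S.
rewrite inE; apply/andP/imsetP => [[/cliquesP[SX cS kS] vS]|[T /cliquesP[]]].
  exists (S :\ v); last by rewrite setD1K.
  apply/cliquesP; split.
  - by rewrite subsetI clique_nbr // (subset_trans _ SX) // subD1set.
  - by have := cardsD1 v S; rewrite vS cS add1n => -[].
  - by apply: clique_sub kS; apply: subD1set.
rewrite subsetI => /andP[TX Tv] cT kT ->; split; last by rewrite setU11.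
apply/cliquesP; split; last exact: clique_setU1.
- by rewrite subUset sub1set vX.
- by rewrite cardsU1 cT nbr_notin.
Qed.

Lemma cliques_split (G : sgraph) s (X Z : {set G}) :
  #|cliques s X| = #|cliques s (X :\: Z)| +
                   #|[set S in cliques s X | S :&: Z != set0]|.
Proof.
rewrite -(cardsID [set S : {set G} | S :&: Z == set0] (cliques s X)).
congr addn; apply: eq_card => S; rewrite !inE; last by rewrite andbC.
by rewrite subsetD setI_eq0; case: [disjoint _ & _]; rewrite ?andbF ?andbT.
Qed.

(** Double counting of the pairs of a vertex [u] and a clique [S] with [u] in [S :&: Z]. *)
Lemma sum_links (G : sgraph) s (X Z : {set G}) : Z \subset X ->
  \sum_(u in Z) #|cliques s (X :&: nbr u)| =
  \sum_(S in [set S in cliques s.+1 X | S :&: Z != set0]) #|S :&: Z|.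
Proof.
move=> /subsetP ZX.
under eq_bigr => u uZ do rewrite -card_cliques_link ?ZX // -sum1_card.
rewrite (exchange_big_dep (mem (cliques s.+1 X))) /=; last first.
  by move=> u S _; rewrite inE => /andP[].
rewrite [RHS](big_setID [set S : {set G} | true]) /=.
rewrite (bigID (fun S : {set G} => S :&: Z == set0)) /= big1 ?add0n; last first.
  move=> S /andP[_ /eqP SZ]; rewrite big1 // => u /andP[uZ].
  rewrite inE => /andP[_ uS]; have : u \in S :&: Z by rewrite inE uS.
  by rewrite SZ inE.
rewrite [X in _ + X]big1 ?addn0; last by move=> S; rewrite !inE.
apply: eq_big => [S|S /andP[SX _]]; first by rewrite !inE andbT.
by rewrite sum1_card; apply: eq_card => u; rewrite !inE -topredE /= !inE in SX *;
   rewrite SX andbC.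
Qed.

Lemma cliques_split_le (G : sgraph) s (X Z : {set G}) : Z \subset X ->
  #|cliques s.+1 X| <=
  #|cliques s.+1 (X :\: Z)| + \sum_(u in Z) #|cliques s (X :&: nbr u)|.
Proof.
move=> ZX; rewrite (cliques_split _ X Z) leq_add2l sum_links // -sum1_card.
by apply: leq_sum => S; rewrite inE card_gt0 => /andP[].
Qed.

(** A clique meets an independent set in at most one vertex, so the double count has no
    repetition. *)
Lemma cliques_split_eq (G : sgraph) s (X Z : {set G}) : Z \subset X ->
  {in Z &, forall x y, ~~ adj x y} ->
  #|cliques s.+1 X| =
  #|cliques s.+1 (X :\: Z)| + \sum_(u in Z) #|cliques s (X :&: nbr u)|.
Proof.
move=> ZX Zi; rewrite (cliques_split _ X Z) sum_links //; congr addn.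
rewrite -sum1_card; apply: eq_bigr => S; rewrite inE -card_gt0.
move=> /andP[/cliquesP[_ _ /cliqueP kS]] S0.
apply/eqP; rewrite eqn_leq S0 /=; apply/card_le1_eqP => x y.
rewrite !inE => /andP[xS xZ] /andP[yS yZ]; apply/eqP; apply: contraT => xy.
by have := Zi _ _ xZ yZ; rewrite kS // eq_sym.
Qed.

Definition multipartite (G : sgraph) (k : nat) (c : G -> nat) (X : {set G}) :=
  {in X, forall x, c x < k} /\ {in X &, forall x y, adj x y = (c x != c y)}.

Definition parts (G : sgraph) (c : G -> nat) (X : {set G}) (L : seq nat) :=
  [seq #|[set x in X | c x == i]| | i <- L].

(** Peel off the first colour class: it is independent, and each of its vertices sees exactly the
    other classes. This is the recursion of [elemsym]; an arbitrary colour list [L] lets the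
    induction drop its head. *)
Lemma card_cliques_parts (G : sgraph) (c : G -> nat) (X : {set G}) (L : seq nat) (s : nat) :
  uniq L -> {in X, forall x, c x \in L} ->
  {in X &, forall x y, adj x y = (c x != c y)} ->
  #|cliques s X| = elemsym (parts c X L) s.
Proof.
elim: L X s => [|i L IH] X s /=.
  move=> _ XL _; have -> : X = set0 by apply/setP => x; rewrite inE; apply/negP => /XL.
  by case: s => [|s]; rewrite ?cliques0 ?cards1 ?cliques_set0 ?cards0.
move=> /andP[iL uL] XL Xadj; case: s => [|s]; first by rewrite cliques0 cards1 elemsym0.
set Z := [set x in X | c x == i].
have ZX : Z \subset X by apply/subsetP => x; rewrite inE => /andP[].
rewrite (cliques_split_eq _ ZX); last first.
  move=> x y; rewrite !inE => /andP[xX /eqP xi] /andP[yX /eqP yi].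
  by rewrite Xadj // xi yi eqxx.
have YX x : x \in X :\: Z -> x \in X by rewrite inE => /andP[].
have YL : {in X :\: Z, forall x, c x \in L}.
  move=> x; rewrite !inE negb_and => /andP[/orP[/negP//|xi] xX].
  by have := XL x xX; rewrite inE (negbTE xi).
have pE : parts c X L = parts c (X :\: Z) L.
  apply/eq_in_map => j jL; apply: eq_card => x; rewrite !inE.
  case: (x \in X) => //=; rewrite ?andbF ?andbT //.
  by case: eqP => [->|]; rewrite ?andbF // andbT; apply/esym; apply: contraNneq iL => <-.
have IHY s' := IH (X :\: Z) s' uL YL (fun x y xY yY => Xadj x y (YX x xY) (YX y yY)).
rewrite IHY -pE; congr addn.
rewrite (eq_bigr (fun => elemsym (parts c X L) s)) ?sum_nat_const // => u.
rewrite inE => /andP[uX /eqP ui]; rewrite pE -IHY; congr #|pred_of_set (cliques _ _)|.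
apply/setP => x; rewrite !inE; case xX: (x \in X) => //=; rewrite andbT.
by rewrite Xadj // ui eq_sym.
Qed.

Lemma card_cliques_multipartite (G : sgraph) k (c : G -> nat) (X : {set G}) s :
  multipartite k c X -> #|cliques s X| = elemsym (parts c X (iota 0 k)) s.
Proof.
move=> [ck cadj]; apply: card_cliques_parts => //; first exact: iota_uniq.
by move=> x /ck; rewrite mem_iota.
Qed.

Lemma sumn_parts (G : sgraph) k (c : G -> nat) (X : {set G}) :
  {in X, forall x, c x < k} -> sumn (parts c X (iota 0 k)) = #|X|.
Proof.
move=> ck; rewrite /parts sumnE big_map -[k in iota 0 k]subn0 big_mkord.
rewrite (eq_bigr (fun i : 'I_k => \sum_(x in X | c x == i) 1)) => [|i _]; last first.
  by rewrite sum1dep_card.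
rewrite -sum1_card (exchange_big_dep (mem X)) /=; last by move=> i x _ /andP[].
apply: eq_bigr => x xX; rewrite (big_pred1 (Ordinal (ck x xX))) // => i.
by rewrite xX /= -val_eqE eq_sym.
Qed.

Lemma eq_sum_leq (I : finType) (P : pred I) (F H : I -> nat) :
  (forall i, P i -> F i <= H i) -> \sum_(i | P i) F i = \sum_(i | P i) H i ->
  forall i, P i -> F i = H i.
Proof.
move=> FH /eqP; rewrite (leqif_sum (fun i Pi => leqif_eq (FH i Pi))).
by move=> /forall_inP E i Pi; apply/eqP/E.
Qed.

(** * Zykov's theorem *)

Lemma cliques_nbr_eq0 (G : sgraph) k (X : {set G}) (v : G) : v \in X ->
  cliques k.+1 X = set0 -> cliques k (X :&: nbr v) = set0.
Proof.
move=> vX X0; apply/eqP; rewrite -cards_eq0 -card_cliques_link // cards_eq0.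
apply/eqP/setP => S; rewrite in_set0; apply/negP.
by rewrite inE X0 in_set0.
Qed.

Lemma cliques1_eq0 (G : sgraph) (X : {set G}) : cliques 1 X = set0 -> X = set0.
Proof.
move=> X0; apply/setP => x; rewrite [RHS]in_set0; apply/negP => xX.
have := cliques_nbr_eq0 xX X0; rewrite cliques0 => /setP/(_ set0).
by rewrite inE eqxx in_set0.
Qed.

Lemma zykov_step (G : sgraph) s (X : {set G}) (v : G) : v \in X ->
  (forall u, u \in X -> #|cliques s (X :&: nbr u)| <= #|cliques s (X :&: nbr v)|) ->
  #|cliques s.+1 X| <= #|cliques s.+1 (X :&: nbr v)| +
    #|X :\: nbr v| * #|cliques s (X :&: nbr v)|.
Proof.
move=> vX vmax; apply: leq_trans (cliques_split_le s (subsetDl X (nbr v))) _.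
rewrite setDDr setDv set0U leq_add2l -sum_nat_const.
by apply: leq_sum => u /setDP[/vmax].
Qed.

(* Let [v] lie in the most s-cliques.  An s-clique either lies in the
   neighbourhood of [v], to which induction applies, or contains a vertex outside
   it; the latter number at most [#|X :\: nbr v|] times the cliques through [v].
   The total is the number of s-cliques of a complete multipartite graph. *)
Lemma zykov (G : sgraph) k s (X : {set G}) : cliques k.+1 X = set0 ->
  #|cliques s X| <= elemsym (bal #|X| k) s.
Proof.
elim: k s X => [|k IH] s X X0.
  rewrite (cliques1_eq0 X0) cards0.
  by case: s => [|s]; rewrite ?cliques0 ?cards1 ?cliques_set0 ?cards0.
case: s => [|s]; first by rewrite cliques0 cards1 elemsym0.
have [->|[v0 v0X]] := set_0Vmem X; first by rewrite cliques_set0 cards0.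
case: (@arg_maxnP _ v0 (mem X) (fun v => #|cliques s (X :&: nbr v)|) v0X).
move=> v vX vmax; have Y0 := cliques_nbr_eq0 vX X0.
apply: leq_trans (zykov_step vX vmax) _.
apply: leq_trans (leq_add (IH _ _ Y0) (leq_mul (leqnn _) (IH _ _ Y0))) _.
case: (posnP k) => [k0|k0].
  move: Y0; rewrite k0 => /cliques1_eq0 Y0; rewrite Y0 cards0.
  have -> : #|X| = #|X :\: nbr v| by rewrite -(cardsID (nbr v) X) Y0 cards0.
  by rewrite /bal divn1 modn1 /=.
have := elemsym_bal_max (#|X :\: nbr v| :: bal #|X :&: nbr v| k) s.+1.
by rewrite [sumn _]/= [size _]/= sumn_bal // size_bal // addnC cardsID.
Qed.

(** Equality must hold at each stage of the proof of the bound. By induction the neighbourhood [Y]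
    of a vertex [v] of maximum clique degree is complete [k]-partite. Its complement [Z] in [X]
    turns out to be joined completely to [Y], hence independent, as an edge in [Z] would extend a
    [k]-clique of [Y] too far. So [Z] is one more part. *)
Lemma zykov_eq (G : sgraph) k (X : {set G}) : cliques k.+1 X = set0 ->
  0 < #|cliques k X| -> #|cliques k X| = elemsym (bal #|X| k) k ->
  exists c, multipartite k c X.
Proof.
elim: k X => [|k IH] X X0.
  move=> _ _; exists (fun=> 0); rewrite (cliques1_eq0 X0).
  by split=> x; rewrite in_set0.
have [->|[v0 v0X]] := set_0Vmem X; first by rewrite cliques_set0 cards0.
case: (@arg_maxnP _ v0 (mem X) (fun v => #|cliques k (X :&: nbr v)|) v0X).
move=> v vX vmax {v0 v0X}; have Y0 := cliques_nbr_eq0 vX X0 => N0 NE.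
set Y := X :&: nbr v in vmax Y0; set Z := X :\: nbr v.
have ZX : Z \subset X by apply: subsetDl.
have XZ : X :\: Z = Y by rewrite setDDr setDv set0U.
have split1 := cliques_split k.+1 X Z.
have split2 := cliques_split_le k ZX.
have sumZ : \sum_(u in Z) #|cliques k (X :&: nbr u)| <= \sum_(u in Z) #|cliques k Y|.
  by apply: leq_sum => u /setDP[/vmax].
have YIH := zykov k Y0.
(* Adding [Z] as a part to the balanced parts on [Y] gives a partition of [X] that is at best
   balanced. *)
have balX : #|Z| * elemsym (bal #|Y| k) k <= elemsym (bal #|X| k.+1) k.+1.
  case: (posnP k) => [k0|k0].
    move: Y0; rewrite k0 => /cliques1_eq0 Y0.
    have -> : #|X| = #|Z| by rewrite -(cardsID (nbr v) X) -/Y Y0 cards0.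
    by rewrite Y0 cards0 /bal divn1 modn1 /= muln1.
  have := elemsym_bal_max (#|Z| :: bal #|Y| k) k.+1.
  rewrite [sumn _]/= [size _]/= sumn_bal // size_bal // addnC cardsID.
  by rewrite -{2}(size_bal #|Y| k0) elemsym_size_cons size_bal.
rewrite XZ Y0 cards0 !add0n in split1 split2.
rewrite sum_nat_const in sumZ.
have Zgt0 : 0 < #|Z|.
  by rewrite card_gt0; apply/set0Pn; exists v; rewrite !inE adj_irrefl.
(* The number of cliques in [X] is at most [#|Z|] times that in [Y], and this is at most the
   balanced value; equality of the ends makes the chain collapse. *)
have YE : #|cliques k Y| = elemsym (bal #|Y| k) k by nia.
have YN0 : 0 < #|cliques k Y| by nia.
have [c [ck cadj]] := IH Y Y0 YN0 YE.
have sumE : \sum_(u in Z) #|cliques k (X :&: nbr u)| = \sum_(u in Z) #|cliques k Y|.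
  by rewrite sum_nat_const; nia.
have degE u : u \in Z -> #|cliques k (X :&: nbr u)| = #|cliques k Y|.
  by apply: (eq_sum_leq _ sumE) => w /setDP[/vmax].
(* The terms [#|T :&: Z|] are at least 1 and their sum equals the number of terms. *)
have meet1 S : S \in cliques k.+1 X -> #|S :&: Z| = 1.
  move=> SX; pose A := [set S in cliques k.+1 X | S :&: Z != set0].
  have AE : \sum_(T in A) 1 = \sum_(T in A) #|T :&: Z|.
    by rewrite sum1_card -sum_links // sumE sum_nat_const -split1; nia.
  apply/esym; apply: (eq_sum_leq _ AE) => [T|]; first by rewrite inE card_gt0 => /andP[].
  rewrite inE SX /=; apply/negP => /eqP SZ.
  have : S \in cliques k.+1 Y.
    move: SX => /cliquesP[SX cS kS]; apply/cliquesP; split=> //.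
    by rewrite -XZ subsetD SX -setI_eq0 SZ eqxx.
  by rewrite Y0 in_set0.
(* If [u] misses [y], every [k]-clique in the neighbourhood of [u] lies in [Y] without [y]. There
   are as many of these as in all of [Y], against the strict monotonicity of the balanced value. *)
have Zadj u y : u \in Z -> y \in Y -> adj u y.
  move=> uZ yY; apply: contraT => uy.
  have uX : u \in X by apply: (subsetP ZX).
  case: (posnP k) => [k0|k0].
    by move: Y0 yY; rewrite k0 => /cliques1_eq0 ->; rewrite inE.
  have sub : cliques k (X :&: nbr u) \subset cliques k (Y :\ y).
    apply/subsetP => S /cliquesP[]; rewrite subsetI => /andP[SX Su] cS kS.
    have uS : u |: S \in cliques k.+1 X.
      apply/cliquesP; split; last exact: clique_setU1.
        by rewrite subUset sub1set uX.
      by rewrite cardsU1 nbr_notin // cS.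
    apply/cliquesP; split=> //; apply/subsetP => x xS; rewrite in_setD1.
    apply/andP; split.
      by apply: contraNneq uy => <-; have := subsetP Su x xS; rewrite inE.
    rewrite -XZ inE (subsetP SX) // andbT; apply/negP => xZ.
    have /eqP/cards1P[w wE] := meet1 _ uS.
    have : x \in [set w] by rewrite -wE inE xZ andbT; apply/setU1P; right.
    have : u \in [set w] by rewrite -wE inE uZ setU11.
    by move=> /set1P <- /set1P xu; have := nbr_notin Su; rewrite -xu xS.
  have le1 := subset_leq_card sub; rewrite degE // in le1.
  have Yy0 : cliques k.+1 (Y :\ y) = set0.
    by apply/eqP; rewrite -subset0 -Y0 cliquesS // subD1set.
  have le2 := zykov k Yy0.
  have yc : #|Y :\ y| < #|Y| by rewrite (cardsD1 y Y) yY.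
  have := elemsym_bal_smono yc k0 (leq_trans (leq_trans YN0 le1) le2).
  by rewrite -YE ltnNge (leq_trans le1).
have Zind : {in Z &, forall x y, ~~ adj x y}.
  move=> x y xZ yZ; apply/negP => xy.
  have /card_gt0P[S /cliquesP[SY cS kS]] := YN0.
  have sub u : u \in Z -> S \subset nbr u.
    by move=> uZ; apply/subsetP => w /(subsetP SY) wY; rewrite inE Zadj.
  have SX : S \subset X by apply: subset_trans SY _; apply: subsetIl.
  have yS : y |: S \subset nbr x.
    by rewrite subUset sub1set inE xy sub.
  have : x |: (y |: S) \in cliques k.+2 X.
    apply/cliquesP; split.
    - by rewrite !subUset !sub1set !(subsetP ZX).
    - by rewrite !cardsU1 !nbr_notin ?cS // sub.
    - by do 2?apply: clique_setU1; rewrite ?sub.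
  by rewrite X0 inE.
have XYZ x : x \in X -> (x \in Y) = (x \notin Z).
  by rewrite !inE => ->; rewrite andbT negbK.
exists (fun x => if x \in Z then k else c x); split.
  by move=> x xX; case: ifPn => // xZ; apply/ltnW/ck; rewrite XYZ.
have neq x : x \in Y -> k != c x by move=> /ck; apply: contraTneq => <-; rewrite ltnn.
move=> x y xX yX; case: ifPn => xZ; case: ifPn => yZ.
- by rewrite eqxx; apply/negbTE/Zind.
- by rewrite Zadj ?neq ?XYZ.
- by rewrite adj_sym Zadj ?XYZ // eq_sym neq ?XYZ.
- by rewrite cadj ?XYZ.
Qed.

(** * Isomorphisms of complete multipartite graphs *)

Lemma eq_card_bij (T T' : finType) : #|T| = #|T'| -> exists f : T -> T', bijective f.
Proof.
move=> E; exists (fun x => enum_val (cast_ord E (enum_rank x))).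
apply: inj_card_bij; last by rewrite E.
by move=> x y /enum_val_inj/cast_ord_inj/enum_rank_inj.
Qed.

Lemma associated_hypergraphE (r : nat) (G : sgraph) :
  associated_hypergraph r G = cliques r [set: G].
Proof.
apply/setP => S; rewrite !inE subsetT /=; case: eqP => //= cS.
apply/isomorphicP/cliqueP => [[f f_bij f_adj] x y xS yS xy|kS].
  have := f_adj (exist _ x xS) (exist _ y yS).
  rewrite [X in _ = X -> _]/= /induced_adj /= => <-; rewrite /complete_adj.
  by apply: contraNneq xy => /(bij_inj f_bij) [->].
have [f f_bij] : exists f : induced S -> complete r, bijective f.
  by apply: eq_card_bij; rewrite card_ord card_sig.
exists f => // u v; rewrite /= /complete_adj (inj_eq (bij_inj f_bij)).
rewrite /induced_adj; case: eqP => [->|uv]; first by rewrite adj_irrefl.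
apply/esym/kS; [exact: valP|exact: valP|].
by apply/eqP => /val_inj.
Qed.

Lemma num_cliquesE (r : nat) (G : sgraph) : num_cliques r G = #|cliques r [set: G]|.
Proof. by rewrite /num_cliques associated_hypergraphE. Qed.

Lemma num_cliques_mono (r : nat) (G H : sgraph) (f : G -> H) :
  injective f -> {mono f : x y / adj x y} -> num_cliques r G <= num_cliques r H.
Proof.
move=> f_inj f_adj; rewrite !num_cliquesE -(card_imset _ (imset_inj f_inj)).
apply/subset_leq_card/subsetP => _ /imsetP[S /cliquesP[_ cS /cliqueP kS] ->].
apply/cliquesP; split; rewrite ?subsetT ?card_imset //.
apply/cliqueP => _ _ /imsetP[x xS ->] /imsetP[y yS ->].
by rewrite (inj_eq f_inj) f_adj; apply: kS.
Qed.

Lemma isomorphic_num_cliques (r : nat) (G H : sgraph) :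
  isomorphic G H -> num_cliques r G = num_cliques r H.
Proof.
case/isomorphicP => f [g fK gK] f_adj; apply/eqP; rewrite eqn_leq.
rewrite (num_cliques_mono r (can_inj fK) f_adj) (num_cliques_mono r (can_inj gK)) //.
by move=> x y; rewrite -f_adj !gK.
Qed.

(** A permutation [Is] of the colours matches classes of equal size; a vertex goes to the vertex
    with the same index in the matched class. [y0] is the default for [nth]. *)
Lemma multipartite_isomorphic (G H : sgraph) k (c : G -> nat) (d : H -> nat) (y0 : H) :
  multipartite k c [set: G] -> multipartite k d [set: H] ->
  perm_eq (parts c [set: G] (iota 0 k)) (parts d [set: H] (iota 0 k)) ->
  isomorphic G H.
Proof.
move=> [ck cadj] [dk dadj] cd.
have [Is] := perm_iotaP 0 cd; rewrite size_map size_iota => Is_perm Is_map.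
have sz : size Is = k by rewrite (perm_size Is_perm) size_iota.
pose A i := [set x | c x == i]; pose B i := [set y | d y == i].
have cA x : x \in A (c x) by rewrite inE.
have cardAB x : #|A (c x)| = #|B (nth 0 Is (c x))|.
  have xk : c x < k by apply: ck.
  have Isk : nth 0 Is (c x) < k.
    have : nth 0 Is (c x) \in iota 0 k by rewrite -(perm_mem Is_perm) mem_nth ?sz.
    by rewrite mem_iota.
  have := congr1 (fun s => nth 0 s (c x)) Is_map.
  rewrite /parts (nth_map 0) ?size_iota // (nth_map 0) ?sz //.
  rewrite (nth_map 0) ?size_iota // !nth_iota // !add0n => E.
  by rewrite -[LHS](@eq_card _ [set z in setT | c z == c x]) ?E;
     [apply: eq_card|] => z; rewrite !inE.
pose f x := nth y0 (enum (B (nth 0 Is (c x)))) (index x (enum (A (c x)))).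
have ix x : index x (enum (A (c x))) < size (enum (B (nth 0 Is (c x)))).
  by rewrite -cardE -cardAB cardE index_mem mem_enum cA.
have df x : d (f x) = nth 0 Is (c x).
  by have := mem_nth y0 (ix x); rewrite mem_enum inE => /eqP.
have Is_eq x y : (nth 0 Is (c x) == nth 0 Is (c y)) = (c x == c y).
  by rewrite nth_uniq ?sz ?ck // (perm_uniq Is_perm) iota_uniq.
have f_inj : injective f.
  move=> x y fxy; have /eqP := congr1 d fxy; rewrite !df Is_eq => /eqP cxy.
  move: fxy (ix x) (ix y); rewrite /f cxy => /eqP fxy xi yi.
  have ixy : index x (enum (A (c y))) = index y (enum (A (c y))).
    by apply/eqP; rewrite nth_uniq ?enum_uniq in fxy.
  have xA : x \in enum (A (c y)) by rewrite mem_enum -cxy.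
  have yA : y \in enum (A (c y)) by rewrite mem_enum.
  by rewrite -(nth_index x xA) ixy nth_index.
apply/isomorphicP; exists f.
  apply: inj_card_bij => //; rewrite -!cardsT -(sumn_parts ck) -(sumn_parts dk).
  by rewrite (perm_sumn cd).
by move=> x y; rewrite cadj ?inE // dadj ?inE // !df Is_eq.
Qed.

(** Each vertex of [W] is adjacent to all others and so forms a part by itself. These parts take the
    colours below [p], and [c] is shifted by [p]. *)
Lemma multipartite_join (G : sgraph) p k (c : G -> nat) (W : {set G}) : #|W| = p ->
  (forall w x, w \in W -> x != w -> adj w x) -> multipartite k c (~: W) ->
  exists2 d, multipartite (p + k) d [set: G] &
    parts d [set: G] (iota 0 (p + k)) = nseq p 1 ++ parts c (~: W) (iota 0 k).
Proof.
move=> cW Wadj [ck cadj].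
have iW x : (index x (enum W) < p) = (x \in W) by rewrite -cW cardE index_mem mem_enum.
pose d x := if x \in W then index x (enum W) else p + c x.
exists d; first split.
- move=> x _; rewrite /d; case: ifPn => xW; first by rewrite ltn_addr ?iW.
  by rewrite ltn_add2l ck // inE.
- move=> x y _ _; rewrite /d; case: ifPn => xW; case: ifPn => yW.
  + case: (eqVneq x y) => [->|xy]; first by rewrite adj_irrefl eqxx.
    rewrite Wadj 1?eq_sym //; apply/esym; apply: contraNneq xy => E.
    have := @nth_index _ x x (enum W); rewrite -E nth_index ?mem_enum // => -> //.
  + rewrite Wadj // ?neq_ltn ?ltn_addr ?iW //.
    by apply: contraNneq yW => ->.
  + rewrite adj_sym Wadj // ?neq_ltn ?ltn_addr ?iW ?orbT //.
    by apply: contraNneq xW => ->.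
  + by rewrite eqn_add2l cadj // inE.
rewrite /parts iotaD map_cat add0n; congr cat.
  apply: (@eq_from_nth _ 0); rewrite size_map size_iota ?size_nseq // => i ip.
  rewrite nth_nseq ip (nth_map 0) ?size_iota // nth_iota // add0n.
  have iw : i < size (enum W) by rewrite -cardE cW.
  have /card_gt0P[w0 _] : 0 < #|W| by rewrite cW (leq_trans _ ip).
  rewrite -(cards1 (nth w0 (enum W) i)); apply: eq_card => x; rewrite !inE /d.
  case: ifPn => xW.
    apply/eqP/eqP => [<-|->]; first by rewrite nth_index // mem_enum.
    by rewrite index_uniq // enum_uniq.
  rewrite gtn_eqF ?(leq_trans ip) ?leq_addr //; apply/esym; apply: contraNF xW => /eqP ->.
  by rewrite -mem_enum mem_nth.
rewrite -[p in iota p]addn0 iotaDl -map_comp; apply/eq_in_map => i; rewrite mem_iota => /= ik.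
apply: eq_card => x; rewrite !inE /d; case: ifPn => xW /=; last by rewrite eqn_add2l.
by rewrite ltn_eqF // ltn_addr // iW.
Qed.

(** * Part sizes of the Turan graph and of its join with a complete graph *)

Lemma card_residue m k i : i < k ->
  #|[set j : 'I_m | j %% k == i]| = m %/ k + (i < m %% k).
Proof.
move=> ik; have k0 : 0 < k by apply: leq_trans ik.
rewrite -sum1dep_card big_mkcond /= -(big_mkord predT (fun j => if j %% k == i then 1 else 0)).
elim: m => [|m IH]; first by rewrite big_nil div0n mod0n.
rewrite big_nat_recr //= IH divnS // modnS.
case: (boolP (k %| m.+1)) => [km|_] /=; last by case: eqP; lia.
have : k <= (m %% k).+1.
  apply: dvdn_leq => //; move: km; rewrite {1}(divn_eq m k) -addnS.
  by rewrite dvdn_addr // dvdn_mull.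
by have := ltn_pmod m k0; case: eqP; lia.
Qed.

Lemma parts_turan m k : 0 < k ->
  [seq #|[set j : 'I_m | j %% k == i]| | i <- iota 0 k] = bal m k.
Proof.
move=> k0; have jk : m %% k <= k by rewrite ltnW ?ltn_mod.
rewrite -[k in iota 0 k](subnKC jk) iotaD map_cat add0n; congr cat.
  apply: (@eq_from_nth _ 0); rewrite size_map size_iota ?size_nseq // => i ip.
  rewrite nth_nseq ip (nth_map 0) ?size_iota // nth_iota // add0n.
  by rewrite card_residue ?ip ?addn1 //; apply: leq_trans ip jk.
apply: (@eq_from_nth _ 0); rewrite size_map size_iota ?size_nseq // => i ip.
rewrite nth_nseq ip (nth_map 0) ?size_iota // nth_iota //.
by rewrite card_residue; [rewrite ltnNge leq_addr addn0|lia].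
Qed.

Lemma join_complete_turan_multipartite p m k : 0 < k ->
  exists2 d, multipartite (p + k) d [set: join (complete p) (turan m k)] &
    parts d [set: join (complete p) (turan m k)] (iota 0 (p + k)) = nseq p 1 ++ bal m k.
Proof.
move=> k0; set E := join _ _.
(* The value 0 on the left summand is a dummy: [c] colours only the complement of [W]. *)
pose c (u : E) := if u is inr j then nat_of_ord j %% k else 0.
pose W : {set E} := [set u : E | if u is inl _ then true else false].
have WE : W = [set inl i | i : 'I_p] :> {set E}.
  apply/setP => -[i|j]; rewrite inE; first by rewrite imset_f.
  by apply/esym/negP => /imsetP[].
have cW : #|W| = p.
  by rewrite WE card_imset ?card_ord //; apply: inl_inj.
have Wadj w x : w \in W -> x != w -> adj w x.
  case: w => [i|j]; rewrite inE // => _; case: x => [i'|//].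
  by move=> ii'; rewrite /= /complete_adj eq_sym; apply: contraNneq ii' => ->.
have cmul : multipartite k c (~: W).
  split; first by move=> [i|j]; rewrite !inE // ltn_pmod.
  by move=> [i|j] [i'|j']; rewrite !inE.
have [d dm dp] := multipartite_join cW Wadj cmul; exists d => //.
rewrite dp -(parts_turan m k0); congr cat; apply: eq_map => i.
rewrite -(card_imset _ (@inr_inj 'I_p 'I_m)); apply: eq_card => -[i'|j]; rewrite !inE.
  by apply/esym/negP => /imsetP[].
by rewrite mem_imset ?inE //; apply: inr_inj.
Qed.

(** * Heavy sets *)

Lemma leq_ffact_expn m j : m ^_ j <= m ^ j.
Proof.
elim: j m => [|j IH] m; first by rewrite ffactn0.
rewrite ffactnS expnS leq_mul2l; apply/orP; right; apply: leq_trans (IH _) _.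
by case: j {IH} => // j; rewrite leq_exp2r // leq_pred.
Qed.

Lemma leq_bin_expn m j : 'C(m, j) <= m ^ j.
Proof.
apply: leq_trans (leq_ffact_expn m j); rewrite -bin_ffact leq_pmulr //.
exact: fact_gt0.
Qed.

Lemma leq_card_supersets (T : finType) (X : {set T}) j :
  #|[set A : {set T} | X \subset A & #|A| == #|X| + j]| <= #|T| ^ j.
Proof.
apply: leq_trans (leq_bin_expn _ _); rewrite -card_draws.
set S := [set A | _].
have SX A : A \in S -> A :&: X = X by rewrite inE => /andP[/setIidPr].
have inj : {in S &, injective (fun A => A :\: X)}.
  move=> A B /SX XA /SX XB AB.
  by rewrite -(setID A X) -(setID B X) AB XA XB.
rewrite -(card_in_imset inj); apply/subset_leq_card/subsetP => _ /imsetP[A AS ->].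
by rewrite inE cardsD SX //; move: AS; rewrite inE => /andP[_ /eqP ->]; rewrite addKn.
Qed.

Lemma leq_card_cliques (G : sgraph) s (X : {set G}) : #|cliques s X| <= #|G| ^ s.
Proof.
apply: leq_trans (leq_bin_expn _ _); rewrite -card_draws; apply/subset_leq_card.
by apply/subsetP => S /cliquesP[_ cS _]; rewrite inE cS.
Qed.

Definition common (G : sgraph) (K : {set G}) : {set G} := [set v | K \subset nbr v].

Lemma cliques_common (G : sgraph) p s (K D : {set G}) :
  K \in cliques p setT -> D \in cliques s (common K) ->
  K :|: D \in cliques (p + s) setT.
Proof.
move=> /cliquesP[_ cK kK] /cliquesP[/subsetP DK cD kD].
have KD x y : x \in K -> y \in D -> adj y x.
  by move=> xK /DK; rewrite inE => /subsetP/(_ x xK); rewrite inE.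
apply/cliquesP; split; first exact: subsetT.
  rewrite cardsU cK cD (_ : K :&: D = set0) ?cards0 ?subn0 //.
  apply/setP => x; rewrite !inE; apply/negP => /andP[xK xD].
  by have := KD x x xK xD; rewrite adj_irrefl.
by apply: cliqueU => // x y xK yD _; rewrite adj_sym KD.
Qed.

(** Cliques with the fixed trace [K] on [W] are determined by their part outside [W], which is a
    clique in the common neighbourhood of [K]. *)
Lemma leq_card_trace (G : sgraph) s (K W : {set G}) (X : {set {set G}}) :
  (forall A, A \in X -> [/\ clique A, #|A| = #|K| + s & A :&: W = K]) ->
  #|X| <= #|cliques s (common K :\: W)|.
Proof.
move=> XP; have inj : {in X &, injective (fun A => A :\: W)}.
  move=> A B /XP[_ _ AK] /XP[_ _ BK] AB.
  by rewrite -(setID A W) -(setID B W) AB AK BK.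
rewrite -(card_in_imset inj); apply/subset_leq_card/subsetP => _ /imsetP[A AX ->].
have [kA cA AK] := XP A AX; apply/cliquesP; split.
- apply/subsetP => x /setDP[xA xW]; rewrite !inE xW /= -AK.
  apply/subsetP => y /setIP[yA yW]; rewrite inE; move/cliqueP: kA; apply=> //.
  by apply: contraNneq xW => ->.
- by rewrite cardsD AK cA addKn.
- by apply: clique_sub kA; apply: subsetDl.
Qed.

Lemma leq_card_remove (G : sgraph) s (X D : {set G}) :
  #|cliques s.+1 X| <= #|cliques s.+1 (X :\: D)| + #|D| * #|G| ^ s.
Proof.
apply: leq_trans (cliques_split_le s (subsetIl X D)) _.
rewrite setDIr setDv set0U leq_add2l.
apply: leq_trans (leq_mul (subset_leq_card (subsetIr X D)) (leqnn _)).
by rewrite -sum_nat_const; apply: leq_sum => u _; apply: leq_card_cliques.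
Qed.

(** * Non-trivially intersecting clique families, with [r = t + k + 1] and [k = l + 1] *)

Section Intersecting.

Variables (G : sgraph) (t l : nat).

Local Notation n := #|G|.
Local Notation r := (t + l.+2).
Local Notation F := (cliques r [set: G]).
Local Notation turan_max := (elemsym (bal n l.+1) l.+1).

Hypothesis t_gt0 : 0 < t.
Hypothesis F_int : {in F &, forall A B, t <= #|A :&: B|}.
Hypothesis F_nontriv : #|\bigcap_(A in F) A| < t.

Definition deg (K : {set G}) := #|[set A in F | K \subset A]|.

Definition heavy (K : {set G}) := (#|K| == t.+1) && (r * n ^ l < deg K).

(** Otherwise every clique through [K] contains [z |: K] for one of at most [r] vertices [z] of [Z].
    Each such set has [t + 2] elements and lies in at most [n^l] sets of size [r], which contradicts
    heaviness. *)
Lemma heavy_avoid (K Z : {set G}) : heavy K -> #|Z| <= r ->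
  exists A, [/\ A \in F, K \subset A & A :&: Z \subset K].
Proof.
move=> /andP[/eqP cK Kdeg] Zr.
pose S z := [set A : {set G} | z |: K \subset A & #|A| == #|z |: K| + l].
have [/existsP[A /and3P[AF KA AZ]]|/existsPn none] :=
  boolP [exists A, [&& A \in F, K \subset A & A :&: Z \subset K]].
  by exists A.
suff sub : [set A in F | K \subset A] \subset \bigcup_(z in Z :\: K) S z.
  move: Kdeg; rewrite ltnNge => /negP[]; apply: leq_trans (subset_leq_card sub) _.
  apply: leq_trans (leq_card_bigcup _ _) _.
  apply: leq_trans (_ : \sum_(z in Z :\: K) n ^ l <= _).
    by apply: leq_sum => z _; apply: leq_card_supersets.
  rewrite sum_nat_const leq_mul2r; apply/orP; right; apply: leq_trans Zr.
  by apply: subset_leq_card; apply: subsetDl.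
apply/subsetP => A; rewrite inE => /andP[AF KA]; have := none A.
rewrite AF KA => /subsetPn[z /setIP[zA zZ] zK]; apply/bigcupP; exists z.
  by rewrite inE zK.
move: AF => /cliquesP[_ cA _].
by rewrite inE subUset sub1set zA KA cardsU1 zK cK cA; apply/eqP; clear; lia.
Qed.

Lemma heavy_clique (K : {set G}) : heavy K -> K \in cliques t.+1 setT.
Proof.
move=> hK; have [|A [/cliquesP[_ _ kA] KA _]] := @heavy_avoid K set0 hK.
  by rewrite cards0.
move: hK => /andP[/eqP cK _]; apply/cliquesP; split=> //.
exact: clique_sub kA.
Qed.

(** Take a clique [A] through [K] that meets [B] only inside [K]; then [A :&: B] is contained in
    [B :&: K]. *)
Lemma heavy_meet (K B : {set G}) : heavy K -> B \in F -> t <= #|B :&: K|.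
Proof.
move=> hK BF; have [|A [AF KA AB]] := @heavy_avoid K B hK.
  by move: BF => /cliquesP[_ ->].
apply: leq_trans (F_int AF BF) _; apply/subset_leq_card/subsetP => x xAB.
by rewrite inE (subsetP AB) // andbT; case/setIP: xAB.
Qed.

Lemma heavy_heavy (K L : {set G}) : heavy K -> heavy L -> t <= #|K :&: L|.
Proof.
move=> hK hL; have [|A [AF KA AL]] := @heavy_avoid K L hK.
  by move: hL => /andP[/eqP -> _]; clear; lia.
apply: leq_trans (heavy_meet hL AF) _; apply/subset_leq_card/subsetP => x xAL.
by rewrite inE (subsetP AL) //=; case/setIP: xAL.
Qed.

Lemma nontriv_witness (T : {set G}) : t <= #|T| -> exists2 B, B \in F & ~~ (T \subset B).
Proof.
move=> tT; apply/exists_inP; apply: contraLR F_nontriv; rewrite negb_exists -leqNgt.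
move=> /forallP H; apply: leq_trans tT _; apply/subset_leq_card/bigcapsP => B BF.
by have := H B; rewrite BF /= negbK.
Qed.

(* A clique contains a [t]-subset [T] of a fixed clique and, by nontriviality,
   a further vertex of a clique chosen not to contain [T]. *)
Lemma card_light :
  #|[set A in F | ~~ [exists K, heavy K && (K \subset A)]]| <= 2 ^ r * (r * (r * n ^ l)).
Proof.
set Fl := [set A in F | _].
have [->|[A1]] := set_0Vmem Fl; first by rewrite cards0.
rewrite inE => /andP[A1F _]; have cA1 : #|A1| = r by move: A1F => /cliquesP[].
pose B (T : {set G}) := odflt set0 [pick B in F | ~~ (T \subset B)].
have BF (T : {set G}) : t <= #|T| -> (B T \in F) && ~~ (T \subset B T).
  move=> tT; rewrite /B; case: pickP => [B' //|none].
  by have [B' BF TB] := nontriv_witness tT; have := none B'; rewrite BF TB.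
have cB (T : {set G}) : #|B T| <= r.
  rewrite /B; case: pickP => [B' /andP[/cliquesP[_ -> _]]//|_].
  by rewrite cards0.
pose S (T : {set G}) (x : G) := if (#|x |: T| == t.+1) && ~~ heavy (x |: T)
              then [set A in F | x |: T \subset A] else set0.
have cS (T : {set G}) x : #|S T x| <= r * n ^ l.
  rewrite /S; case: ifP => [/andP[cT]|]; last by rewrite cards0.
  by rewrite /heavy cT -leqNgt.
(* There are [2 ^ r] choices of [T] inside [A1], at most [r] of [x] in [B T], and at most
   [r * n ^ l] cliques through a set [x |: T] that is not heavy. *)
have sub : Fl \subset \bigcup_(T in powerset A1) \bigcup_(x in B T) S T x.
  apply/subsetP => A; rewrite inE => /andP[AF Alight].
  have : 0 < #|[set T : {set G} | T \subset A :&: A1 & #|T| == t]|.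
    by rewrite cards_draws bin_gt0 F_int.
  case/card_gt0P => T; rewrite inE subsetI => /andP[/andP[TA TA1] /eqP cT].
  have /andP[BTF TB] := BF T (eq_leq (esym cT)).
  have [x /setIP[xA xB] xT] : exists2 x, x \in A :&: B T & x \notin T.
    apply/subsetPn; apply: contra TB => sub.
    have E : A :&: B T = T by apply/eqP; rewrite eqEcard sub cT F_int.
    by rewrite -{1}E subsetIr.
  apply/bigcupP; exists T; first by rewrite inE.
  apply/bigcupP; exists x => //.
  have xTA : x |: T \subset A by rewrite subUset sub1set xA.
  rewrite /S cardsU1 xT cT eqxx /=; case: ifPn; first by rewrite inE AF.
  move/negPn => hxT; case/negP: Alight; apply/existsP; exists (x |: T).
  by rewrite hxT.
apply: leq_trans (subset_leq_card sub) _; apply: leq_trans (leq_card_bigcup _ _) _.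
have -> : 2 ^ r = #|powerset A1| by rewrite card_powerset cA1.
rewrite -sum_nat_const; apply: leq_sum => T _.
apply: leq_trans (leq_card_bigcup _ _) _.
apply: leq_trans (_ : \sum_(x in B T) r * n ^ l <= _); first exact: leq_sum.
by rewrite sum_nat_const leq_mul2r cB orbT.
Qed.

Lemma card_F_le :
  #|F| <= #|[set A in F | [exists K, heavy K && (K \subset A)]]|
          + 2 ^ r * (r * (r * n ^ l)).
Proof.
rewrite -(cardsID [set A : {set G} | [exists K, heavy K && (K \subset A)]] F).
apply: leq_add; first by apply/eq_leq/eq_card => A; rewrite !inE.
apply: leq_trans card_light; apply/eq_leq/eq_card => A; rewrite !inE andbC //.
Qed.

Lemma elemsym_bal_le_turan_max (X : {set G}) :
  elemsym (bal #|X| l.+1) l.+1 <= turan_max.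
Proof. by apply: elemsym_bal_mono => //; apply: max_card. Qed.

(* Disjoint (l+2)-cliques [D], [D'] in the common neighbourhood of [K] would
   give cliques [K :\ x :|: D] and [K :\ y :|: D'] meeting in [t - 1] vertices. *)
Lemma deg_heavy (K : {set G}) : heavy K -> deg K <= turan_max + l.+2 * n ^ l.
Proof.
move=> hK; have KC := heavy_clique hK; have [_ cK kK] := cliquesP _ _ _ KC.
have degC : deg K <= #|cliques l.+1 (common K)|.
  have -> : common K = common K :\: K.
    apply/setP => v; rewrite !inE; case: (boolP (v \in K)) => //= vK.
    by apply/negbTE/negP => /nbr_notin; rewrite vK.
  apply: leq_trans (leq_card_trace _); first exact: leqnn.
  move=> A; rewrite inE => /andP[/cliquesP[_ cA kA] /setIidPr KA].
  by split=> //; rewrite cK cA; clear; lia.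
apply: leq_trans degC _.
have [D0|[D DC]] := set_0Vmem (cliques l.+2 (common K)).
  apply: leq_trans (zykov _ D0) _; apply: leq_trans (elemsym_bal_le_turan_max _) _.
  exact: leq_addr.
have [DK cD kD] := cliquesP _ _ _ DC.
apply: leq_trans (leq_card_remove _ _ D) _; rewrite cD leq_add2r.
apply: leq_trans (elemsym_bal_le_turan_max (common K :\: D)); apply: zykov.
apply/eqP/set0Pn => -[D' /cliquesP[D'K cD' kD']].
have [x [y [xK yK xy]]] : exists x y, [/\ x \in K, y \in K & x != y].
  by apply/card_gt1P; rewrite cK.
have inF z E : z \in K -> E \in cliques l.+2 (common K) -> (K :\ z) :|: E \in F.
  move=> zK /cliquesP[EK cE kE]; apply: cliques_common.
    apply/cliquesP; split; [exact: subsetT| |exact: clique_sub (subsetDl _ _) kK].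
    by have := cardsD1 z K; rewrite zK cK => -[].
  apply/cliquesP; split=> //; apply: subset_trans EK _; apply/subsetP => v.
  by rewrite !inE; apply: subset_trans; apply: subsetDl.
have D'C : D' \in cliques l.+2 (common K).
  by apply/cliquesP; split=> //; apply: subset_trans D'K (subsetDl _ _).
have := F_int (inF _ _ xK DC) (inF _ _ yK D'C); rewrite leqNgt => /negP[].
have sub : (K :\ x :|: D) :&: (K :\ y :|: D') \subset (K :\ x) :\ y.
  have notK v (E : {set G}) : v \in E -> E \subset common K -> v \notin K.
    by move=> vE EK; have := subsetP EK v vE; rewrite inE => /nbr_notin.
  apply/subsetP => v; rewrite !inE => /andP[/orP[/andP[vx vK]|vD]].
    case/orP=> [/andP[vy _]|vD']; first by rewrite vx vy.
    have := notK v _ vD' (subset_trans D'K (subsetDl _ _)); by rewrite vK.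
  case/orP=> [/andP[vy vK]|vD']; first by have := notK v _ vD DK; rewrite vK.
  by have := subsetP D'K v vD'; rewrite inE vD.
apply: leq_ltn_trans (subset_leq_card sub) _.
have := cardsD1 x K; have := cardsD1 y (K :\ x).
rewrite xK cK !inE yK eq_sym xy /= !add1n => <- [->].
exact: leqnn.
Qed.

Lemma card_F_few_heavy : #|[set K | heavy K]| <= t.+1 ->
  #|F| <= t.+1 * (turan_max + l.+2 * n ^ l) + 2 ^ r * (r * (r * n ^ l)).
Proof.
move=> Ht; apply: leq_trans card_F_le _; rewrite leq_add2r.
have sub : [set A in F | [exists K, heavy K && (K \subset A)]] \subset
           \bigcup_(K in [set K | heavy K]) [set A in F | K \subset A].
  apply/subsetP => A; rewrite inE => /andP[AF /existsP[K /andP[hK KA]]].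
  by apply/bigcupP; exists K; rewrite inE // AF.
apply: leq_trans (subset_leq_card sub) _; apply: leq_trans (leq_card_bigcup _ _) _.
apply: leq_trans (leq_mul Ht (leqnn _)); rewrite -sum_nat_const.
by apply: leq_sum => K; rewrite inE; apply: deg_heavy.
Qed.

(** Sets of size [t + 1] that pairwise share [t] elements either all lie in one set of size [t + 2]
    or all contain one set of size [t]. The candidates are the union [W] and the intersection [T] of
    two heavy sets; a heavy set outside [W] forces the second case. *)
Lemma heavy_dichotomy : t.+1 < #|[set K | heavy K]| ->
  (exists2 W : {set G}, #|W| = t.+2 & {in W, forall w, heavy (W :\ w)}) \/
  (exists (T : {set G}) (b1 b2 b3 : G),
    [/\ #|T| = t, [/\ heavy (b1 |: T), heavy (b2 |: T) & heavy (b3 |: T)],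
        [/\ b1 != b2, b1 != b3 & b2 != b3] &
        forall K, heavy K -> T \subset K]).
Proof.
move=> Ht; have [K1 [K2 []]] : exists K1 K2,
    [/\ K1 \in [set K | heavy K], K2 \in [set K | heavy K] & K1 != K2].
  by apply/card_gt1P; apply: leq_trans Ht.
rewrite !inE => h1 h2 K12.
have cH K : heavy K -> #|K| = t.+1 by case/andP => /eqP.
pose W := K1 :|: K2; pose T := K1 :&: K2.
have neq_meet K L : heavy K -> heavy L -> K != L -> #|K :&: L| = t.
  move=> hK hL KL; apply/eqP; rewrite eqn_leq heavy_heavy // andbT.
  rewrite -ltnS -(cH K hK) ltn_neqAle subset_leq_card ?subsetIl // andbT.
  apply: contraNneq KL => E.
  have /setIidPl KsL : K :&: L = K by apply/eqP; rewrite eqEcard subsetIl E leqnn.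
  by rewrite eqEcard KsL (cH K hK) (cH L hL) leqnn.
have cT : #|T| = t by apply: neq_meet.
have cW : #|W| = t.+2 by rewrite cardsU (cH _ h1) (cH _ h2) -/T cT; clear; lia.
have [/forall_inP subW|] := boolP [forall (K | heavy K), K \subset W].
  left; exists W => // w wW.
  (* [W] has exactly [t + 2] subsets of size [t + 1], and there are at least that many heavy
     sets. *)
  have E : [set K | heavy K] = [set K : {set G} | K \subset W & #|K| == t.+1].
    apply/eqP; rewrite eqEcard cards_draws cW binSn Ht andbT.
    by apply/subsetP => K; rewrite !inE => hK; rewrite subW // (cH K hK) eqxx.
  have : W :\ w \in [set K | heavy K]; last by rewrite inE.
  rewrite E inE subD1set; apply/eqP.
  by have := cardsD1 w W; rewrite wW cW => -[].
case/forall_inPn => K3 h3 K3W; right.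
have dec K : heavy K -> T \subset K -> exists2 b, b \in K :\: T & K = b |: T.
  move=> hK TK; have /cards1P[b bE] : #|K :\: T| == 1.
    by rewrite cardsD (setIidPr TK) cT (cH K hK) subSnn.
  by exists b; rewrite ?bE ?inE //; rewrite -(setID K T) (setIidPr TK) bE setUC.
have T3 : T \subset K3.
  have lt : #|K3 :&: W| <= t.
    rewrite -ltnS -(cH K3 h3) ltn_neqAle subset_leq_card ?subsetIl // andbT.
    apply: contraNneq K3W => E; apply/setIidPl/eqP.
    by rewrite eqEcard subsetIl E leqnn.
  have meetW K : heavy K -> K \subset W -> K3 :&: W \subset K.
    move=> hK KW; have /eqP <- : K3 :&: K == K3 :&: W.
      by rewrite eqEcard setIS //= (leq_trans lt) // heavy_heavy.
    exact: subsetIr.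
  have sub : K3 :&: W \subset T.
    by rewrite subsetI !meetW // ?subsetUl ?subsetUr.
  have /eqP <- : K3 :&: W == T.
    rewrite eqEcard sub cT; apply: leq_trans (heavy_heavy h3 h1) _.
    by apply: subset_leq_card; rewrite setIS // subsetUl.
  exact: subsetIl.
have [b1 b1K E1] := dec K1 h1 (subsetIl _ _).
have [b2 b2K E2] := dec K2 h2 (subsetIr _ _).
have [b3 b3K E3] := dec K3 h3 T3.
have K13 : K1 != K3 by apply: contraNneq K3W => <-; apply: subsetUl.
have K23 : K2 != K3 by apply: contraNneq K3W => <-; apply: subsetUr.
have b12 : b1 != b2 by apply: contraNneq K12 => b; rewrite E1 E2 b.
have b13 : b1 != b3 by apply: contraNneq K13 => b; rewrite E1 E3 b.
have b23 : b2 != b3 by apply: contraNneq K23 => b; rewrite E2 E3 b.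
exists T, b1, b2, b3; rewrite -E1 -E2 -E3; split=> // K hK.
apply: contraT => TK.
(* A heavy [K] not containing [T] must contain [b1], [b2], [b3] and at least [t - 1] elements of
   [T], which is more than [t + 1] elements. *)
have KT : #|K :&: T| < t.
  rewrite -cT ltn_neqAle subset_leq_card ?subsetIr // andbT.
  apply: contraNneq TK => E; apply/setIidPr/eqP.
  by rewrite eqEcard subsetIr E leqnn.
have bK b : heavy (b |: T) -> b \in K.
  move=> hb; have := heavy_heavy hK hb; rewrite leqNgt; apply: contraNT => bK.
  apply: leq_ltn_trans KT; apply/subset_leq_card/subsetP => x.
  rewrite !inE => /andP[xK /orP[/eqP xb|->]]; last by rewrite xK.
  by rewrite -xb xK in bK.
have b1K' : b1 \in K by apply: bK; rewrite -E1.
have b2K' : b2 \in K by apply: bK; rewrite -E2.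
have b3K' : b3 \in K by apply: bK; rewrite -E3.
have sub : b1 |: (b2 |: (b3 |: (K :&: T))) \subset K.
  by rewrite !subUset !sub1set b1K' b2K' b3K' subsetIl.
have := subset_leq_card sub; rewrite (cH K hK) !cardsU1 !inE.
rewrite (negbTE b12) (negbTE b13) (negbTE b23) /=.
move: b1K b2K b3K; rewrite !inE => /andP[/negbTE b1T _] /andP[/negbTE b2T _].
move=> /andP[/negbTE b3T _]; rewrite b1T b2T b3T !andbF /=.
have := heavy_heavy hK h1; rewrite E1.
have : #|K :&: (b1 |: T)| <= #|K :&: T|.+1.
  rewrite setIUr; apply: leq_trans (leq_card_setU _ _) _; rewrite -add1n leq_add2r.
  by rewrite -(cards1 b1) subset_leq_card // subsetIr.
by move: #|K :&: (b1 |: T)| #|K :&: T| => x y; clear; lia.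
Qed.

(** * All heavy sets share a [t]-set, and there are at least three *)

Section Star.

Variables (T : {set G}) (b1 b2 b3 : G).
Hypothesis cT : #|T| = t.
Hypothesis hb1 : heavy (b1 |: T).
Hypothesis hb2 : heavy (b2 |: T).
Hypothesis hb3 : heavy (b3 |: T).
Hypothesis b12 : b1 != b2.
Hypothesis b13 : b1 != b3.
Hypothesis b23 : b2 != b3.
Hypothesis T_heavy : forall K, heavy K -> T \subset K.

(** Such a clique together with [T] would be an [r]-clique meeting [A0] only inside [T :&: A0], in
    fewer than [t] vertices. *)
Lemma star_common_cliques (A0 : {set G}) : A0 \in F -> ~~ (T \subset A0) ->
  cliques l.+2 (common T :\: A0) = set0.
Proof.
move=> A0F TA0; apply/eqP/set0Pn => -[D /cliquesP[DT cD kD]].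
have TD : T :|: D \in F.
  apply: cliques_common; last first.
    by apply/cliquesP; split=> //; apply: subset_trans DT (subsetDl _ _).
  apply/cliquesP; split=> //.
  have [_ _ kb] := cliquesP _ _ _ (heavy_clique hb1).
  exact: clique_sub (subsetUr _ _) kb.
have := F_int TD A0F; rewrite leqNgt => /negP[].
apply: leq_ltn_trans (_ : #|T :&: A0| < t).
  apply/subset_leq_card/subsetP => x; rewrite !inE => /andP[/orP[-> ->//|xD] xA0].
  by have := subsetP DT x xD; rewrite inE xA0.
rewrite -[X in _ < X]cT ltn_neqAle subset_leq_card ?subsetIl // andbT.
by apply: contraNneq TA0 => E; apply/setIidPl/eqP; rewrite eqEcard subsetIl E leqnn.
Qed.

Lemma star_heavy_in (A0 : {set G}) b : A0 \in F -> ~~ (T \subset A0) ->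
  heavy (b |: T) -> b \in A0.
Proof.
move=> A0F TA0 hb; have := heavy_meet hb A0F; apply: contraTT => bA0.
rewrite -ltnNge -cT; apply: proper_card; rewrite properE; apply/andP; split.
  apply/subsetP => x; rewrite !inE => /andP[xA0 /orP[/eqP xb|//]].
  by rewrite -xb xA0 in bA0.
by apply: contra TA0 => /subset_trans; apply; apply: subsetIl.
Qed.

(* If [A] and [A'] differ only in the vertices [b], [b'] of [A0], then trading a
   vertex of [T] for [b'] in [A] gives a clique too far from a third heavy set. *)
Lemma star_trace_inj (A0 A A' : {set G}) b b' : A0 \in F -> ~~ (T \subset A0) ->
  A \in F -> A' \in F -> T \subset A -> T \subset A' ->
  A :&: (A0 :\: T) = [set b] -> A' :&: (A0 :\: T) = [set b'] ->
  A :\: (T :|: A0) = A' :\: (T :|: A0) -> A = A'.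
Proof.
move=> A0F TA0 AF A'F TA TA' Ab A'b AA'.
have dec (B : {set G}) c : T \subset B -> B :&: (A0 :\: T) = [set c] ->
    B = T :|: [set c] :|: (B :\: (T :|: A0)).
  move=> TB <-; apply/setP => x; have := subsetP TB x; rewrite !inE.
  by case: (x \in T); case: (x \in B); case: (x \in A0) => //= ->.
have [bb|bb] := eqVneq b b'.
  by rewrite (dec A b) // (dec A' b') // AA' bb.
have /setIP[bA /setDP[bA0 bT]] : b \in A :&: (A0 :\: T) by rewrite Ab set11.
have /setIP[b'A' /setDP[b'A0 b'T]] : b' \in A' :&: (A0 :\: T) by rewrite A'b set11.
have b'A : b' \notin A.
  have -> : (b' \in A) = (b' == b) by rewrite -in_set1 -Ab !inE b'A0 b'T !andbT.
  by rewrite eq_sym.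
have sub x : x \in A -> x != b -> x \in A'.
  rewrite (dec A b) // AA' !inE => /orP[/orP[xT|->//]|/andP[_ -> //]] _.
  exact: (subsetP TA').
have [b'' [hb'' b''b b''b']] : exists b'', [/\ heavy (b'' |: T), b'' != b & b'' != b'].
  have [E1|n1] := eqVneq b1 b.
    have [E2|n2] := eqVneq b2 b'; last by exists b2; rewrite -E1 eq_sym.
    by exists b3; rewrite -E1 -E2 !(eq_sym b3).
  have [E1|n1'] := eqVneq b1 b'; last by exists b1.
  have [E2|n2] := eqVneq b2 b; last by exists b2; rewrite -E1 (eq_sym b2 b1).
  by exists b3; rewrite -E1 -E2 !(eq_sym b3).
have [x xT] : exists x, x \in T by apply/card_gt0P; rewrite cT.
have xA := subsetP TA x xT.
have [_ cA kA] := cliquesP _ _ _ AF.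
have SF : b' |: (A :\ x) \in F.
  apply/cliquesP; split; first exact: subsetT.
    by rewrite cardsU1 !inE (negbTE b'A) andbF -cA (cardsD1 x A) xA.
  apply: clique_setU1; first by apply: clique_sub kA; apply: subsetDl.
  apply/subsetP => y /setD1P[_ yA]; rewrite inE.
  have b'y : b' != y by apply: contraNneq b'A => ->.
  have [yb|yb] := eqVneq y b.
    by have [_ _ /cliqueP->] := cliquesP _ _ _ A0F; rewrite // yb.
  by have [_ _ /cliqueP->] := cliquesP _ _ _ A'F; rewrite // sub.
have := heavy_meet hb'' SF; rewrite leqNgt => /negP[].
have b''A : b'' \notin A.
  have b''A0 := star_heavy_in A0F TA0 hb''.
  have b''T : b'' \notin T.
    move: hb'' => /andP[/eqP]; rewrite cardsU1 cT; case: (b'' \in T) => //= E _.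
    by move: E; clear; lia.
  by have -> : (b'' \in A) = (b'' == b) by rewrite -in_set1 -Ab !inE b''A0 b''T !andbT.
apply: leq_ltn_trans (_ : #|T :\ x| < t).
  apply/subset_leq_card/subsetP => y; rewrite !inE => /andP[yS /orP[/eqP yb|yT]].
    by move: yS; rewrite yb (negbTE b''A) (negbTE b''b') andbF.
  rewrite yT andbT; case/orP: yS => [/eqP yb|/andP[-> //]].
  by rewrite -yb yT in b'T.
by have := cardsD1 x T; rewrite xT cT => ->.
Qed.

(** Fix a clique [A0] not containing [T]. A clique through a heavy set contains [T] and a vertex of
    [A0 :\: T]. Those with exactly one such vertex inject into the [(l+1)]-cliques of the
    [K_(l+2)]-free set [common T :\: A0]; those with two contain one of at most [r * r] sets of size
    [t + 2]. The last term counts cliques without heavy subset. *)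
Lemma card_F_star :
  #|F| <= turan_max + r * (r * n ^ l) + 2 ^ r * (r * (r * n ^ l)).
Proof.
apply: leq_trans card_F_le _; rewrite leq_add2r.
have [A0 A0F TA0] := nontriv_witness (eq_leq (esym cT)).
have cA0 : #|A0| = r by move: A0F => /cliquesP[].
set H := [set A in F | _].
have HP A : A \in H -> [/\ A \in F, T \subset A & 0 < #|A :&: (A0 :\: T)|].
  rewrite inE => /andP[AF /existsP[K /andP[hK KA]]]; split=> //.
    by apply: subset_trans KA; apply: T_heavy.
  have := T_heavy hK => TK; have /andP[/eqP cK _] := hK.
  have /card_gt0P[b] : 0 < #|K :\: T| by rewrite cardsD (setIidPr TK) cT cK subSnn.
  move=> /setDP[bK bT]; have KE : K = b |: T.
    apply/esym/eqP; rewrite eqEcard subUset sub1set bK TK /=.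
    by rewrite cardsU1 bT cT cK.
  apply/card_gt0P; exists b; rewrite !inE bT (subsetP KA) //=.
  by apply: star_heavy_in => //; rewrite -KE.
pose H1 := [set A in H | #|A :&: (A0 :\: T)| == 1].
rewrite -(cardsID H1 H); apply: leq_add.
  have inj : {in H1 &, injective (fun A => A :\: (T :|: A0))}.
    move=> A A'; rewrite [A \in _]in_set [A' \in _]in_set.
    move=> /andP[/(HP A)[AF TA _] /cards1P[b Ab]].
    move=> /andP[/(HP A')[A'F TA' _] /cards1P[b' A'b]] AA'.
    exact: star_trace_inj A0F TA0 AF A'F TA TA' Ab A'b AA'.
  apply: leq_trans (elemsym_bal_le_turan_max (common T :\: A0)).
  apply: leq_trans (zykov _ (star_common_cliques A0F TA0)).
  apply: leq_trans (subset_leq_card (subsetIr _ _)) _.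
  rewrite -(card_in_imset inj); apply/subset_leq_card/subsetP => _ /imsetP[A AH ->].
  move: AH; rewrite in_set => /andP[/(HP A)[AF TA _] /cards1P[b Ab]].
  have [_ cA kA] := cliquesP _ _ _ AF; apply/cliquesP; split.
  - apply/subsetP => x; rewrite !inE negb_or => /andP[/andP[xT xA0] xA].
    rewrite xA0; apply/subsetP => y yT; rewrite inE; move/cliqueP: kA; apply=> //.
      exact: (subsetP TA).
    by apply: contraNneq xT => ->.
  - have -> : A :\: (T :|: A0) = A :\: (b |: T).
      rewrite -Ab; apply/setP => x; rewrite !inE.
      by case: (x \in T); case: (x \in A0); case: (x \in A).
    have : b \in A :&: (A0 :\: T) by rewrite Ab set11.
    rewrite !inE => /and3P[bA bT _].
    rewrite cardsD (setIidPr _) ?subUset ?sub1set ?bA // cardsU1 bT cT cA; clear; lia.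
  - by apply: clique_sub kA; apply: subsetDl.
pose S x y := [set A : {set G} | y |: (x |: T) \subset A & #|A| == #|y |: (x |: T)| + l].
have sub : H :\: H1 \subset
    \bigcup_(x in A0 :\: T) \bigcup_(y in (A0 :\: T) :\ x) S x y.
  apply/subsetP => A /setDP[AH AH1]; have [AF TA A1] := HP A AH.
  have : 1 < #|A :&: (A0 :\: T)|.
    by rewrite ltn_neqAle A1 andbT eq_sym; apply: contra AH1 => E; rewrite in_set AH.
  case/card_gt1P => x [y [/setIP[xA xA0] /setIP[yA yA0] xy]].
  apply/bigcupP; exists x => //; apply/bigcupP; exists y.
    by rewrite in_setD1 eq_sym xy.
  have [_ cA _] := cliquesP _ _ _ AF.
  rewrite inE !subUset !sub1set xA yA TA /= !cardsU1 !inE (eq_sym y) (negbTE xy) /=.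
  move: xA0 yA0; rewrite !inE => /andP[/negbTE -> _] /andP[/negbTE -> _].
  by rewrite cT cA; apply/eqP => /=; clear; lia.
apply: leq_trans (subset_leq_card sub) _; apply: leq_trans (leq_card_bigcup _ _) _.
have cD : #|A0 :\: T| <= r by rewrite -cA0 subset_leq_card // subsetDl.
apply: leq_trans (_ : \sum_(x in A0 :\: T) r * n ^ l <= _); last first.
  by rewrite sum_nat_const leq_mul2r cD orbT.
apply: leq_sum => x _; apply: leq_trans (leq_card_bigcup _ _) _.
apply: leq_trans (_ : \sum_(y in (A0 :\: T) :\ x) n ^ l <= _).
  by apply: leq_sum => y _; apply: leq_card_supersets.
rewrite sum_nat_const leq_mul2r (leq_trans _ cD) ?orbT //.
by rewrite subset_leq_card // subD1set.
Qed.

End Star.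

(** * The heavy sets include all [(t+1)]-subsets of a [(t+2)]-set [W] *)

Section Core.

Variable W : {set G}.
Hypothesis cW : #|W| = t.+2.
Hypothesis W_heavy : {in W, forall w, heavy (W :\ w)}.

Local Notation m := #|~: W|.

(** As [t > 0], [A] contains some [w] in [W]; besides [w] it has at least [t] vertices in the heavy
    set [W :\ w]. *)
Lemma core_meet (A : {set G}) : A \in F -> t < #|A :&: W|.
Proof.
move=> AF; have /card_gt0P[w0 w0W] : 0 < #|W| by rewrite cW.
have /card_gt0P[w] : 0 < #|A :&: (W :\ w0)|.
  by apply: leq_trans (heavy_meet (W_heavy w0W) AF).
move=> /setIP[wA /setD1P[_ wW]]; have := heavy_meet (W_heavy wW) AF.
by rewrite setIDA (cardsD1 w (A :&: W)) !inE wA wW.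
Qed.

(** [W] has at least three vertices, so both lie in the heavy clique [W :\ y] for a third vertex
    [y]. *)
Lemma core_complete w x : w \in W -> x \in W -> w != x -> adj w x.
Proof.
move=> wW xW wx; have : 0 < #|(W :\ w) :\ x|.
  have xWw : x \in W :\ w by rewrite !inE eq_sym wx.
  have := cardsD1 w W; have := cardsD1 x (W :\ w).
  by rewrite cW wW xWw; move: t_gt0; clear; lia.
move=> /card_gt0P[y]; rewrite !inE => /and3P[yx yw yW].
have [_ _ /cliqueP->] := cliquesP _ _ _ (heavy_clique (W_heavy yW)) => //.
  by rewrite !inE eq_sym yw.
by rewrite !inE eq_sym yx.
Qed.

(** Such a clique and [t] vertices of [W :\ w] would form an [r]-clique with only [t] vertices in
    [W]. *)
Lemma core_common_cliques w : w \in W ->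
  cliques l.+2 (common (W :\ w) :\: W) = set0.
Proof.
move=> wW; apply/eqP/set0Pn => -[D /cliquesP[DC cD kD]].
have [x xW] : exists x, x \in W :\ w.
  by apply/card_gt0P; have := cardsD1 w W; rewrite wW cW; clear; lia.
have DW : D \subset ~: W.
  by apply/subsetP => y /(subsetP DC); rewrite !inE => /andP[].
have SF : ((W :\ w) :\ x) :|: D \in F.
  apply: cliques_common.
    have [_ _ kW] := cliquesP _ _ _ (heavy_clique (W_heavy wW)).
    apply/cliquesP; split; [exact: subsetT| |exact: clique_sub (subsetDl _ _) kW].
    by have := cardsD1 w W; have := cardsD1 x (W :\ w); rewrite wW xW cW; clear; lia.
  apply/cliquesP; split=> //; apply/subsetP => y /(subsetP DC).
  rewrite !inE => /andP[_]; apply: subset_trans; exact: subsetDl.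
have := core_meet SF; rewrite ltnNge => /negP[].
apply: leq_trans (_ : #|(W :\ w) :\ x| <= _).
  apply/subset_leq_card/subsetP => y; rewrite inE => /andP[/setUP[//|yD] yW].
  by have := subsetP DW y yD; rewrite inE yW.
by have := cardsD1 w W; have := cardsD1 x (W :\ w); rewrite wW xW cW; clear; lia.
Qed.

Definition core_part w := [set A in F | A :&: W == W :\ w].

Lemma card_core_part w : w \in W ->
  #|core_part w| <= #|cliques l.+1 (common (W :\ w) :\: W)|.
Proof.
move=> wW; apply: leq_card_trace => A; rewrite inE => /andP[/cliquesP[_ cA kA] /eqP AW].
by split=> //; have := cardsD1 w W; rewrite wW cW cA; clear; lia.
Qed.

Lemma subset_core_common w : common (W :\ w) :\: W \subset ~: W.
Proof. by apply/subsetP => x; rewrite !inE => /andP[]. Qed.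

Lemma card_core_part_le w : w \in W ->
  #|core_part w| <= elemsym (bal m l.+1) l.+1.
Proof.
move=> wW; apply: leq_trans (card_core_part wW) _.
apply: leq_trans (zykov _ (core_common_cliques wW)) _.
apply: elemsym_bal_mono => //; exact: subset_leq_card (subset_core_common w).
Qed.

(** The other [l] vertices lie in a set without [(l+2)]-cliques, so the clique bound applies in
    degree [l], one below the top. *)
Lemma card_core_all :
  #|[set A in F | W \subset A]| <= elemsym (bal m l.+1) l.
Proof.
have /card_gt0P[w wW] : 0 < #|W| by rewrite cW.
apply: leq_trans (_ : #|cliques l (common W :\: W)| <= _).
  apply: leq_card_trace => A; rewrite inE => /andP[/cliquesP[_ cA kA] /setIidPr WA].
  by split=> //; rewrite cW cA; clear; lia.
have sub : common W :\: W \subset common (W :\ w) :\: W.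
  apply: setSD; apply/subsetP => v; rewrite !inE; apply: subset_trans.
  exact: subsetDl.
apply: leq_trans (subset_leq_card (cliquesS l sub)) _.
apply: leq_trans (zykov _ (core_common_cliques wW)) _.
apply: elemsym_bal_mono => //; exact: subset_leq_card (subset_core_common w).
Qed.

Lemma card_F_core_split :
  #|F| <= \sum_(w in W) #|core_part w| + #|[set A in F | W \subset A]|.
Proof.
have sub : F \subset (\bigcup_(w in W) core_part w) :|: [set A in F | W \subset A].
  apply/subsetP => A AF; rewrite in_setU [X in _ || X]inE AF /=.
  have [|WA] := boolP (W \subset A); first by rewrite orbT.
  rewrite orbF; have [w wW wA] := subsetPn WA; apply/bigcupP; exists w => //.
  rewrite inE AF eqEcard /=; apply/andP; split.
    apply/subsetP => x /setIP[xA xW]; rewrite !inE xW andbT.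
    by apply: contraNneq wA => <-.
  by have := cardsD1 w W; have := core_meet AF; rewrite wW cW; clear; lia.
apply: leq_trans (subset_leq_card sub) _; apply: leq_trans (leq_card_setU _ _) _.
by rewrite leq_add2r leq_card_bigcup.
Qed.

Lemma card_F_core :
  #|F| <= t.+2 * elemsym (bal m l.+1) l.+1 + elemsym (bal m l.+1) l.
Proof.
apply: leq_trans card_F_core_split _; apply: leq_add card_core_all.
rewrite -cW -sum_nat_const; apply: leq_sum => w; exact: card_core_part_le.
Qed.

(** Equality forces every [core_part w] to reach its bound. By strict monotonicity each
    [common (W :\ w) :\: W] is then the whole complement of [W], so [W] is joined to everything, and
    the complement attains equality in Zykov's theorem with balanced parts. *)
Lemma core_extremal : l < m ->
  #|F| = t.+2 * elemsym (bal m l.+1) l.+1 + elemsym (bal m l.+1) l ->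
  (forall w x, w \in W -> x != w -> adj w x) /\
  exists2 c, multipartite l.+1 c (~: W) &
    perm_eq (parts c (~: W) (iota 0 l.+1)) (bal m l.+1).
Proof.
move=> lm FE; set M := elemsym _ _ in FE.
(* [l < m] makes every balanced part nonempty; the strictness arguments below rest on this. *)
have M_gt0 : 0 < M.
  by apply: leq_trans (elemsym_bal_ge _ _); rewrite // expn_gt0 divn_gt0 // lm.
have sumE : \sum_(w in W) #|core_part w| = \sum_(w in W) M.
  apply/eqP; rewrite eqn_leq leq_sum => [|w wW]; last exact: card_core_part_le.
  rewrite sum_nat_const cW -(leq_add2r (elemsym (bal m l.+1) l)) -FE.
  by apply: leq_trans card_F_core_split _; rewrite leq_add2l card_core_all.
have partE w : w \in W -> #|core_part w| = M.
  by apply: (eq_sum_leq _ sumE) => v; apply: card_core_part_le.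
(* A smaller common neighbourhood would hold strictly fewer than [M] cliques. *)
have common_full w : w \in W -> common (W :\ w) :\: W = ~: W.
  move=> wW; apply/eqP; rewrite eqEcard subset_core_common leqNgt; apply/negP => lt.
  have le1 := card_core_part wW; rewrite partE // in le1.
  have le2 := leq_trans le1 (zykov l.+1 (core_common_cliques wW)).
  have := elemsym_bal_smono lt (ltn0Sn l) (leq_trans M_gt0 le2).
  by rewrite ltnNge le2.
have /card_gt0P[w0 w0W] : 0 < #|W| by rewrite cW.
have X0 := core_common_cliques w0W; rewrite common_full // in X0.
have XE : #|cliques l.+1 (~: W)| = M.
  apply/eqP; rewrite eqn_leq zykov //= -{1}(partE w0 w0W) -(common_full w0 w0W).
  exact: card_core_part.
split=> [w x wW xw|].
  have [xW|xW] := boolP (x \in W); first by rewrite core_complete // eq_sym.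
  have [v vW] : exists v, v \in W :\ w.
    by apply/card_gt0P; have := cardsD1 w W; rewrite wW cW; clear; lia.
  have [vw vW'] := setD1P vW.
  have : x \in common (W :\ v) :\: W by rewrite common_full ?inE.
  rewrite !inE xW /= => /subsetP/(_ w).
  by rewrite !inE eq_sym vw wW adj_sym => /(_ isT).
have XN : 0 < #|cliques l.+1 (~: W)| by rewrite XE.
have [c cm] := zykov_eq X0 XN XE; exists c => //.
have [ck _] := cm; have := card_cliques_multipartite l.+1 cm; rewrite XE => pE.
have sp : size (parts c (~: W) (iota 0 l.+1)) = l.+1 by rewrite size_map size_iota.
have := @elemsym_bal_eq (parts c (~: W) (iota 0 l.+1)).
by rewrite sp (sumn_parts ck) -pE; apply.
Qed.

End Core.

(** The coefficient of [n ^ l] adds the errors of both bounded cases: heavy degrees, the star, and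
    cliques without heavy subset. *)
Lemma card_F_dichotomy :
  [\/ #|F| <= t.+1 * turan_max +
        (t.+1 * l.+2 + r * r + 2 ^ r * (r * r)) * n ^ l
    | exists2 W : {set G}, #|W| = t.+2 & {in W, forall w, heavy (W :\ w)}].
Proof.
have [Ht|] := leqP #|[set K | heavy K]| t.+1.
  by left; apply: leq_trans (card_F_few_heavy Ht) _; nia.
case/heavy_dichotomy => [?|[T [b1 [b2 [b3 [cT [h1 h2 h3] [b12 b13 b23] TH]]]]]].
  by right.
left; apply: leq_trans (card_F_star cT h1 h2 h3 b12 b13 b23 TH) _; nia.
Qed.

End Intersecting.

(** * The extremal graph *)

(** The join has [p + k] parts, [p] of them singletons, and a clique of size [p + s] misses exactly
    one part. *)
Lemma num_cliques_join (p m k s : nat) : k = s.+1 ->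
  num_cliques (p + s) (join (complete p) (turan m k)) =
  p * elemsym (bal m k) k + elemsym (bal m k) s.
Proof.
move=> ks; have k0 : 0 < k by rewrite ks.
have [d dm dp] := join_complete_turan_multipartite p m k0.
have bk := size_bal m k0.
rewrite num_cliquesE (card_cliques_multipartite _ dm) dp.
by rewrite elemsym_nseq1_cons_pred bk.
Qed.

(** With [q = m %/ l.+1], both balanced values are [q^(l+1)] up to lower-order terms, since [n] and
    [m] differ by a constant. The coefficients [t + 1] and [t + 2] then decide for large [n]. *)
Lemma few_cliques_lt (t l C : nat) : exists n0, forall n m, n0 < n -> n = m + t + 2 ->
  l < m /\ t.+1 * elemsym (bal n l.+1) l.+1 + C * n ^ l < t.+2 * elemsym (bal m l.+1) l.+1.
Proof.
have [M HM] := growth_gap (t + 4) (C * l.+1 ^ l) t.+1 l.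
exists (t + 2 + l.+1 * M.+1) => n m n0 nm; set q := m %/ l.+1.
have Mq : M < q by rewrite leq_divRL // mulnC; lia.
split; first by lia.
(* Division of a sum can carry 1, which with the successor on the left gives [t + 2 + 1 + 1]. *)
have nq : (n %/ l.+1).+1 <= q + (t + 4).
  have := leq_divDl l.+1 m (t + 2); have := leq_div (t + 2) l.+1.
  by rewrite (_ : n = m + (t + 2)) -/q; lia.
apply: leq_trans (leq_mul (leqnn t.+2) (elemsym_bal_ge m (ltn0Sn l))).
apply: leq_ltn_trans (HM q Mq); apply: leq_add.
  rewrite leq_mul2l; apply/orP; right.
  apply: leq_trans (elemsym_bal_le _ _) _ => //.
  by rewrite leq_exp2r.
rewrite -mulnA -expnMn leq_mul2l; apply/orP; right.
have : n <= l.+1 * (q + (t + 4)).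
  apply: leq_trans (ltnW (ltn_ceil n (ltn0Sn l))) _.
  by rewrite mulnC leq_mul2l nq orbT.
by case: (l) => // l'; rewrite leq_exp2r.
Qed.

Lemma card_superset (T : finType) (A : {set T}) s : #|A| <= s <= #|T| ->
  exists2 B : {set T}, A \subset B & #|B| = s.
Proof.
case/andP; elim: s => [|s IH] As sT; first by exists A => //; apply/eqP; rewrite -leqn0.
have [/eqP AE|As'] := eqVneq #|A| s.+1; first by exists A => //; apply/eqP.
have [||B AB Bs] := IH _ _; first by rewrite -ltnS ltn_neqAle As'.
  exact: ltnW.
have /card_gt0P[x xB] : 0 < #|~: B| by rewrite cardsCs setCK Bs subn_gt0.
exists (x |: B); first exact: subset_trans AB (subsetUr _ _).
by rewrite cardsU1 Bs; move: xB; rewrite inE => ->.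
Qed.

(* This covers [r = t + 1], where [turan _ 0] is a complete graph. *)
Lemma num_cliques_complete (r : nat) (G H : sgraph) : 1 < r <= #|G| -> #|G| = #|H| ->
  (forall x y : H, adj x y = (x != y)) ->
  num_cliques r G <= num_cliques r H
  /\ (num_cliques r G = num_cliques r H <-> isomorphic G H).
Proof.
move=> /andP[r1 rG] GH Hadj.
have sub (K : sgraph) : cliques r [set: K] \subset [set S : {set K} | #|S| == r].
  by apply/subsetP => S /cliquesP[_ cS _]; rewrite inE cS.
have HE : num_cliques r H = 'C(#|G|, r).
  rewrite num_cliquesE GH -card_draws; apply/eq_card => S; rewrite !inE subsetT /=.
  by case: eqP => //= _; apply/cliqueP => x y _ _; rewrite Hadj.
have GE := subset_leq_card (sub G); rewrite card_draws in GE.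
rewrite HE num_cliquesE; split=> //; split=> [E|/(isomorphic_num_cliques r)]; last first.
  by rewrite num_cliquesE HE.
have full : cliques r [set: G] = [set S : {set G} | #|S| == r].
  by apply/eqP; rewrite eqEcard sub card_draws E leqnn.
have Gadj (x y : G) : adj x y = (x != y).
  case: (eqVneq x y) => [->|xy]; first by rewrite adj_irrefl.
  have [|S xyS cS] := @card_superset _ [set x; y] r.
    by rewrite rG andbT cards2 xy.
  have : S \in cliques r setT by rewrite full inE cS.
  case/cliquesP => _ _ /cliqueP; apply; rewrite ?xy // (subsetP xyS) //.
    by rewrite set21.
  by rewrite set22.
have [f f_bij] := eq_card_bij GH; apply/isomorphicP; exists f => // x y.
by rewrite Hadj Gadj (inj_eq (bij_inj f_bij)).
Qed.

Theorem theorem1p5 (r t : nat) (ht : 1 <= t) (hrt : t < r) :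
  exists n0 : nat, forall n : nat, n0 < n ->
    let E := join (complete (t + 2)) (turan (n - t - 2) (r - t - 1)) in
    forall G : sgraph, #|G| = n -> nontrivial_clique_intersecting r t G ->
      num_cliques r G <= num_cliques r E
      /\ (num_cliques r G = num_cliques r E <-> isomorphic G E).
Proof.
have [->|rt] := eqVneq r t.+1.
  exists (t + 2) => n n0 E G Gn _; apply: num_cliques_complete.
  - by rewrite Gn; lia.
  - by rewrite Gn /E card_sum !card_ord; lia.
  rewrite /E (_ : t.+1 - t - 1 = 0); last by lia.
  by move=> [i|i] [j|j].
pose l := r - t - 2; have rE : r = t + l.+2 by rewrite /l; lia.
have kE : r - t - 1 = l.+1 by rewrite /l; lia.
have [n0 Hn0] := few_cliques_lt t l
  (t.+1 * l.+2 + r * r + 2 ^ r * (r * r)).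
(* Adding [t + 2] ensures that the subtraction in [n - t - 2] does not truncate. *)
exists (n0 + t + 2) => n nn0 E G Gn [Fint Fnon].
set m := n - t - 2; have nm : n = m + t + 2 by rewrite /m; lia.
have [|lm gap] := Hn0 n m _ nm; first by lia.
have NE : num_cliques r E = t.+2 * elemsym (bal m l.+1) l.+1 + elemsym (bal m l.+1) l.
  rewrite /E -/m kE (_ : r = (t + 2) + l); last by rewrite rE; lia.
  by rewrite num_cliques_join // addn2.
(* Here [A = B] is allowed, since a single clique has [r > t] vertices. *)
have G_int : {in cliques (t + l.+2) [set: G] &, forall A B, t <= #|A :&: B|}.
  move=> A B; rewrite -rE -associated_hypergraphE => AF BF.
  have [->|AB] := eqVneq A B; last exact: Fint.
  move: BF; rewrite setIid inE => /andP[/eqP -> _]; exact: ltnW.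
have G_nontriv : #|\bigcap_(A in cliques (t + l.+2) [set: G]) A| < t.
  by rewrite -rE -associated_hypergraphE.
rewrite NE num_cliquesE [in cliques r]rE.
have [lt|[W cW Wh]] := card_F_dichotomy ht G_int G_nontriv.
  (* Without a core [W] the count is already below the term [t.+2 * elemsym (bal m l.+1) l.+1] of
     the extremal number, so equality is impossible. *)
  have {}lt : #|cliques (t + l.+2) [set: G]| < num_cliques r E.
    rewrite NE; apply: leq_ltn_trans lt _; rewrite Gn -rE.
    by apply: leq_trans gap _; apply: leq_addr.
  rewrite -NE; split; first exact: ltnW.
  split=> [eqE|/(isomorphic_num_cliques r) <-]; first by rewrite eqE ltnn in lt.
  by rewrite num_cliquesE rE.
have cWm : #|~: W| = m by rewrite cardsCs setCK cW Gn nm; lia.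
have := card_F_core ht G_int cW Wh; rewrite cWm => le; split=> //.
split=> [eqE|/(isomorphic_num_cliques r)]; last first.
  by rewrite NE num_cliquesE [in LHS]rE.
have := core_extremal ht G_int cW Wh; rewrite cWm => /(_ lm eqE)[Wadj [c cm cp]].
have [d dm dp] := multipartite_join cW Wadj cm.
have [d' dm' dp'] := join_complete_turan_multipartite (t + 2) m (ltn0Sn l).
rewrite -/m in E NE *; rewrite /E kE.
have v0 : join (complete (t + 2)) (turan m l.+1) by left; exists 0; rewrite addn2.
rewrite -addn2 in dm dp.
by apply: (multipartite_isomorphic v0 dm dm'); rewrite dp dp' perm_cat2l.
Qed.
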